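(* Consider the simultaneous block-fading binary symmetric wiretap channel with parameters $q_1\in[0,1]$, $q_2=1-q_1$, and crossover probabilities satisfying $p_1\le p_2\le 0.5$, $p_1^*\le p_2^*\le 0.5$, $p_1\le p_1^*$, $p_2\le p_2^*$. Its secrecy capacity with channel state information available only at the decoders is $$C^s_{\textrm{CSI-D}}= q_1[H(p_1^* )-H(p_1)]+q_2[H(p_2^* )-H(p_2)].$$
   Context: $H(p)=-p\log_2 p-(1-p)\log_2(1-p)$ is the binary entropy function, and BSC$(p)$ denotes the binary symmetric channel with crossover probability $p$. Simultaneous block-fading binary symmetric wiretap channel: the transmitter sends $NB$ binary symbols $X_{1:NB}$ organized in $B$ fading blocks of length $N$. Each block $k$ has a fading state $S_k\in\{1,2\}$, constant within the block, with $\Pr(S_k=1)=q_1$, $\Pr(S_k=2)=q_2$, states independent across blocks. Within block $k$, the legitimate receiver observes the output $Y$ of $N$ independent uses of BSC$(p_{S_k})$, and the eavesdropper observes the output $Z$ of $N$ independent uses of BSC$(p^*_{S_k})$ (same state for both). Let $\mathsf{S}=(S_1,\dots,S_B)$. A code consists of a (possibly randomized) encoder $X_{1:NB}=f(\mathsf{M})$ of a uniformly distributed message $\mathsf{M}$, which knows only the state distribution (not the realizations), and a decoder $\hat{\mathsf{M}}=g(Y_{1:NB},\mathsf{S})$ that knows the states; its rate is $\frac{1}{NB}\log_2$ of the message-set size. A rate $R$ is achievable if there are such codes of rate at least $R$ (asymptotically) with $N,B\to\infty$ such that $\Pr\{\mathsf{M}\ne\hat{\mathsf{M}}\}\to0$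 and $\frac{1}{NB}I(\mathsf{M};Z_{1:NB}\mid\mathsf{S})\to 0$. $C^s_{\textrm{CSI-D}}$ is the supremum of achievable rates. *)

(* Defs.v *)
From HB Require Import structures.
From mathcomp Require Import all_boot all_order all_algebra.
From mathcomp Require Import all_classical all_reals exp.
Set Implicit Arguments. Unset Strict Implicit. Unset Printing Implicit Defensive.
Import Order.TTheory GRing.Theory Num.Theory.
Local Open Scope ring_scope.

Section BFWiretap.
Variable R : realType.

Definition log2 (x : R) : R := ln x / ln 2.

Definition xlog2 (x : R) : R := if x == 0 then 0 else x * log2 x.

Definition Hb (p : R) : R := - xlog2 p - xlog2 (1 - p).

(* Fading states: 'I_2, where ord0 stands for state 1 and the other element
   for state 2.  [sel a b s] selects the parameter of state s. *)
Definition sel (a b : R) (s : 'I_2) : R := if s == ord0 then a else b.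

(* A codeword of length N*B organised in B blocks of length N:
   symbol (k, j) is the j-th symbol of block k. *)
Definition word (N B : nat) := {ffun 'I_B * 'I_N -> bool}.

Definition stseq (B : nat) := {ffun 'I_B -> 'I_2}.

Definition PS (q1 : R) (B : nat) (s : stseq B) : R :=
  \prod_(k < B) sel q1 (1 - q1) (s k).

Definition bsc (pa pb : R) (N B : nat) (s : stseq B) (x y : word N B) : R :=
  \prod_(i : 'I_B * 'I_N)
     (if y i == x i then 1 - sel pa pb (s i.1) else sel pa pb (s i.1)).

(* A code: message set 'I_M (M >= 1), a randomized encoder (for each message
   a probability distribution on codewords; it does not depend on the
   states), and a decoder that sees the legitimate output and the states. *)
Record code (N B : nat) := Code {
  msize : nat;
  msize_gt0 : (0 < msize)%N;
  enc : 'I_msize -> {ffun word N B -> R};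
  enc_ge0 : forall m x, 0 <= enc m x;
  enc_sum1 : forall m, \sum_(x : word N B) enc m x = 1;
  dec : word N B -> stseq B -> 'I_msize
}.

Arguments msize {N B} c.
Arguments enc {N B} c m.
Arguments dec {N B} c y s.

Definition rate N B (c : code N B) : R := log2 (msize c)%:R / (N * B)%:R.

Definition err_prob (q1 p1 p2 : R) N B (c : code N B) : R :=
  \sum_(s : stseq B) PS q1 s *
   \sum_(m : 'I_(msize c)) (msize c)%:R^-1 *
     \sum_(x : word N B) enc c m x *
       \sum_(y : word N B) bsc p1 p2 s x y * (dec c y s != m)%:R.

Definition pMZ (ps1 ps2 : R) N B (c : code N B) (s : stseq B)
    (m : 'I_(msize c)) (z : word N B) : R :=
  (msize c)%:R^-1 * \sum_(x : word N B) enc c m x * bsc ps1 ps2 s x z.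

Arguments pMZ ps1 ps2 {N B} c s m z.

Definition pZ (ps1 ps2 : R) N B (c : code N B) (s : stseq B) (z : word N B) : R :=
  \sum_(m : 'I_(msize c)) pMZ ps1 ps2 c s m z.

(* I(M; Z | S) in bits (M is independent of S, so Pr(M = m | S = s) = 1/|M|) *)
Definition leakage (q1 ps1 ps2 : R) N B (c : code N B) : R :=
  \sum_(s : stseq B) PS q1 s *
   \sum_(m : 'I_(msize c)) \sum_(z : word N B)
     (let pmz := pMZ ps1 ps2 c s m z in
      if pmz == 0 then 0
      else pmz * log2 (pmz / ((msize c)%:R^-1 * pZ ps1 ps2 c s z))).

Definition eventually (P : nat -> Prop) : Prop :=
  exists J : nat, forall j, (J <= j)%N -> P j.

Definition achievable (q1 p1 p2 ps1 ps2 Rt : R) : Prop :=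
  exists (N B : nat -> nat) (c : forall j, code (N j) (B j)),
    (forall K : nat, eventually (fun j => (K <= N j)%N)) /\
    (forall K : nat, eventually (fun j => (K <= B j)%N)) /\
    (forall eps : R, 0 < eps -> eventually (fun j => Rt - eps <= rate (c j))) /\
    (forall eps : R, 0 < eps ->
       eventually (fun j => `|err_prob q1 p1 p2 (c j)| <= eps)) /\
    (forall eps : R, 0 < eps ->
       eventually (fun j => `|leakage q1 ps1 ps2 (c j) / (N j * B j)%:R| <= eps)).

Definition is_secrecy_capacity_CSID (q1 p1 p2 ps1 ps2 C : R) : Prop :=
  (forall Rt, achievable q1 p1 p2 ps1 ps2 Rt -> Rt <= C) /\
  (forall eps, 0 < eps -> exists Rt, achievable q1 p1 p2 ps1 ps2 Rt /\ C - eps < Rt).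

End BFWiretap.

(* Main.v *)
Require Import Defs.
From HB Require Import structures.
From mathcomp Require Import all_boot all_order all_algebra.
From mathcomp Require Import all_classical all_reals sequences exp.
From mathcomp Require Import ring lra.
Set Implicit Arguments. Unset Strict Implicit. Unset Printing Implicit Defensive.
Import Order.TTheory GRing.Theory Num.Theory.
Local Open Scope ring_scope.

(** Weak converse.  Given the states the eavesdropper's channel is the legitimate
    one followed by a BSC, so by data processing I(M;Y|S) - I(M;Z|S) is at most
    the expected sum of the entropy differences H(ps) - H(p); Fano's inequality
    and the leakage bound then control the rate.

    Achievability.  Take a uniform random codebook with M messages and L
    randomisation indices per message, where L is just above exp(I(X;Z|S)).
    Jensen's inequality in the codewords other than the transmitted one gives
      E[leakage] <= E[ln (1 + 2^n W(z|x) / L)] <= ln 2 + E[(i(X;Z|S) - ln L)^+],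
    and threshold decoding of the pair (message, index) errs with probability at
    most P(i(X;Y|S) <= ln t) + M L / t.  Both tails are governed by the variance
    of the information density, of order B N^2, which is o((N B)^2) as B grows.
    All information quantities inside the proofs are in nats. *)

(** * Product measures and relative entropy *)

Section ProductMeasure.
Variables (R : realType) (I A : finType) (w : I -> A -> R).
Hypothesis w1 : forall i, \sum_a w i a = 1.

Lemma prodw_sum1 : \sum_(f : {ffun I -> A}) \prod_i w i (f i) = 1.
Proof. by rewrite -bigA_distr_bigA big1. Qed.

(** Marginalisation: [u (f i)] is a product over all coordinates [k] whose factors are 1 off [i], so
    the sum over [f] factors and every other coordinate contributes its total mass 1. *)
Lemma prodw_expect1 (i : I) (u : A -> R) :
  \sum_(f : {ffun I -> A}) (\prod_k w k (f k)) * u (f i) = \sum_a w i a * u a.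
Proof.
transitivity (\sum_(f : {ffun I -> A})
    \prod_k (w k (f k) * (if k == i then u (f k) else 1))).
  apply: eq_bigr => f _; rewrite big_split /= -big_mkcond /= big_pred1_eq //.
rewrite -(bigA_distr_bigA (fun k a => w k a * (if k == i then u a else 1))).
rewrite (bigD1 i) //= eqxx [X in _ * X]big1 ?mulr1 // => k /negPf ki.
by rewrite -[RHS](w1 k); apply: eq_bigr => a _; rewrite ki mulr1.
Qed.

Lemma prodw_expect2 (i j : I) (u v : A -> R) : i != j ->
  \sum_(f : {ffun I -> A}) (\prod_k w k (f k)) * (u (f i) * v (f j))
  = (\sum_a w i a * u a) * (\sum_a w j a * v a).
Proof.
move=> ij.
transitivity (\sum_(f : {ffun I -> A})
    \prod_k (w k (f k) * ((if k == i then u (f k) else 1) *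
                          (if k == j then v (f k) else 1)))).
  apply: eq_bigr => f _; rewrite !big_split /= -!big_mkcond /=.
  by rewrite !big_pred1_eq.
rewrite -(bigA_distr_bigA (fun k a => w k a *
  ((if k == i then u a else 1) * (if k == j then v a else 1)))).
rewrite (bigD1 i) //= (bigD1 j) 1?eq_sym //= mulrA [X in _ * X]big1 ?mulr1.
  by congr (_ * _); apply: eq_bigr => a _;
    rewrite eqxx ?[j == i]eq_sym (negPf ij) ?mulr1 ?mul1r.
move=> k /andP[/negPf ki /negPf kj].
by rewrite -[RHS](w1 k); apply: eq_bigr => a _; rewrite ki kj !mulr1.
Qed.

End ProductMeasure.

Section Divergence.
Variable R : realType.
Implicit Types a b c : R.

Lemma ln_le_subr1 c : 0 < c -> ln c <= c - 1.
Proof.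
by move=> c0; have := @le_ln1Dx R (c - 1); rewrite addrCA subrr addr0; apply; lra.
Qed.

(** The bound [ln u <= u - 1] at [u = c * b / a]. The free parameter [c] is a guess for the ratio
    [a / b]. *)
Lemma mul_ln_div_ge a b c : 0 <= a -> 0 <= b -> (b = 0 -> a = 0) -> 0 < c ->
  a * ln c + a - c * b <= a * ln (a / b).
Proof.
move=> a0 b0 ba c0; have [a1|an] := eqVneq a 0.
  by rewrite a1 !mul0r add0r sub0r oppr_le0 mulr_ge0 // ltW.
have ap : 0 < a by rewrite lt_def an.
have bp : 0 < b.
  by rewrite lt_def b0 andbT; apply/eqP => /ba /eqP; rewrite (negPf an).
have h : ln (c * b / a) <= c * b / a - 1.
  by apply: ln_le_subr1; rewrite divr_gt0 ?mulr_gt0.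
move: h; rewrite ln_div ?posrE ?mulr_gt0 // lnM ?posrE // ln_div ?posrE // => h.
have := ler_wpM2l a0 h.
have -> : a * (c * b / a - 1) = c * b - a by field; exact: an.
by lra.
Qed.

Variable T : finType.

(** Variational lower bound on relative entropy, with [c] a trial density of [a] against [b]. A
    constant [c] gives the log-sum inequality and the maximal-entropy bound; a decoder-dependent [c]
    gives Fano's inequality. *)
Lemma gibbs (a b c : T -> R) :
  (forall t, 0 <= a t) -> (forall t, 0 <= b t) -> (forall t, b t = 0 -> a t = 0) ->
  (forall t, 0 < c t) -> \sum_t c t * b t <= \sum_t a t ->
  \sum_t a t * ln (c t) <= \sum_t a t * ln (a t / b t).
Proof.
move=> a0 b0 ba c0 cb.
apply: (@le_trans _ _ (\sum_t (a t * ln (c t) + a t - c t * b t))).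
  by rewrite sumrB big_split /= -addrA lerDl subr_ge0.
by apply: ler_sum => t _; exact: (mul_ln_div_ge (a0 t) (b0 t) (@ba t) (c0 t)).
Qed.

Lemma log_sum (a b : T -> R) :
  (forall t, 0 <= a t) -> (forall t, 0 <= b t) -> (forall t, b t = 0 -> a t = 0) ->
  (\sum_t a t) * ln ((\sum_t a t) / \sum_t b t) <= \sum_t a t * ln (a t / b t).
Proof.
move=> a0 b0 ba; have [A0|An] := eqVneq (\sum_t a t) 0.
  have z t : a t = 0.
    by apply/eqP; move/eqP: A0; rewrite psumr_eq0 // => /allP; apply; rewrite mem_index_enum.
  by rewrite A0 mul0r big1 // => t _; rewrite z mul0r.
have Ap : 0 < \sum_t a t by rewrite lt_def An sumr_ge0.
have Bn : \sum_t b t != 0.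
  apply/eqP => /eqP; rewrite psumr_eq0 // => /allP bz.
  move/eqP: An; apply; apply: big1 => t _; apply: ba.
  by apply/eqP/bz; rewrite mem_index_enum.
have Bp : 0 < \sum_t b t by rewrite lt_def Bn sumr_ge0.
rewrite mulr_suml; apply: gibbs => // [t|]; first exact: divr_gt0.
by rewrite -mulr_sumr divfK.
Qed.

End Divergence.

(** The log-sum inequality for each [z]; then [V y z] cancels inside the logarithm and sums to 1
    outside. Neither [a] nor [b] has to be normalised, so [b] may be the counting measure. *)
Lemma kl_data_processing (R : realType) (Y Z : finType) (a b : Y -> R)
    (V : Y -> Z -> R) :
  (forall y, 0 <= a y) -> (forall y, 0 <= b y) -> (forall y, b y = 0 -> a y = 0) ->
  (forall y z, 0 <= V y z) -> (forall y, \sum_z V y z = 1) ->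
  \sum_z (\sum_y a y * V y z) * ln ((\sum_y a y * V y z) / \sum_y b y * V y z)
  <= \sum_y a y * ln (a y / b y).
Proof.
move=> a0 b0 ba V0 V1.
apply: (@le_trans _ _ (\sum_z \sum_y a y * V y z * ln ((a y * V y z) / (b y * V y z)))).
  apply: ler_sum => z _; apply: log_sum => y; rewrite ?mulr_ge0 //.
  by move/eqP; rewrite mulf_eq0 => /orP[/eqP/ba ->|/eqP ->]; rewrite ?mul0r ?mulr0.
rewrite exchange_big /=; apply: ler_sum => y _.
apply: (@le_trans _ _ (\sum_z V y z * (a y * ln (a y / b y)))); last first.
  by rewrite -mulr_suml V1 mul1r.
apply: ler_sum => z _; have [->|Vn] := eqVneq (V y z) 0; first by rewrite !(mulr0, mul0r).
by rewrite -mulf_div divff // mulr1 mulrCA mulrA.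
Qed.

(** * The block-fading channel *)

(* Since [ln 0 = 0], the convention [0 ln 0 = 0] and its analogues below need no
   case distinction. *)
Definition hnat (R : realType) (p : R) : R := - (p * ln p) - (1 - p) * ln (1 - p).

Lemma HbE (R : realType) (p : R) : Hb p = hnat p / ln 2.
Proof.
have xl (x : R) : xlog2 x = x * ln x / ln 2.
  by rewrite /xlog2 /log2; case: eqP => [->|_]; rewrite ?mul0r // mulrA.
by rewrite /Hb !xl /hnat; ring.
Qed.

Lemma ln2_gt0 (R : realType) : 0 < ln 2 :> R.
Proof. by rewrite ln_gt0 // ltr1n. Qed.

Lemma ln_prod (R : realType) (I : finType) (f : I -> R) :
  (forall i, 0 < f i) -> ln (\prod_i f i) = \sum_i ln (f i).
Proof.
move=> f0; suff [] : 0 < \prod_i f i /\ ln (\prod_i f i) = \sum_i ln (f i) by [].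
apply: (big_ind2 (fun x y => 0 < x /\ ln x = y)) => //.
- by rewrite ln1; split.
- move=> x1 x2 y1 y2 [px <-] [py <-]; rewrite mulr_gt0 //; split=> //.
  by rewrite lnM ?posrE.
Qed.

Section Channel.
Variables (R : realType) (N B : nat).
Implicit Types (s : stseq B) (x y z : word N B) (i : 'I_B * 'I_N).

Definition bsc1 (pa pb : R) s x i (b : bool) : R :=
  if b == x i then 1 - sel pa pb (s i.1) else sel pa pb (s i.1).

Lemma bscE (pa pb : R) s x y : bsc pa pb s x y = \prod_i bsc1 pa pb s x i (y i).
Proof. by []. Qed.

Lemma bscC (pa pb : R) s x y : bsc pa pb s x y = bsc pa pb s y x.
Proof. by apply: eq_bigr => i _; rewrite eq_sym. Qed.

Lemma sum_bsc1 (pa pb : R) s x i (f : bool -> R) :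
  \sum_b bsc1 pa pb s x i b * f b =
  (1 - sel pa pb (s i.1)) * f (x i) + sel pa pb (s i.1) * f (~~ x i).
Proof. by rewrite big_bool /bsc1; case: (x i); rewrite //= addrC. Qed.

Lemma bsc1_sum1 (pa pb : R) s x i : \sum_b bsc1 pa pb s x i b = 1.
Proof.
by transitivity (\sum_b bsc1 pa pb s x i b * 1);
  [apply: eq_bigr => b _; rewrite mulr1|rewrite sum_bsc1; lra].
Qed.

Lemma bsc_sum1 (pa pb : R) s x : \sum_(y : word N B) bsc pa pb s x y = 1.
Proof. exact: (prodw_sum1 (bsc1_sum1 pa pb s x)). Qed.

(** Given [s] both channels are memoryless, so the sum over the intermediate word factors over
    positions. Symmetry of the second channel lets both factors be read as laws of [y i]. *)
Lemma bsc_cascade (pa pb ra rb pa' pb' : R) s x z :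
  pa' = pa * (1 - ra) + (1 - pa) * ra -> pb' = pb * (1 - rb) + (1 - pb) * rb ->
  \sum_(y : word N B) bsc pa pb s x y * bsc ra rb s y z = bsc pa' pb' s x z.
Proof.
move=> Ea Eb.
transitivity (\sum_(y : word N B) \prod_i
    (bsc1 pa pb s x i (y i) * bsc1 ra rb s z i (y i))).
  by apply: eq_bigr => y _; rewrite big_split /= [bsc ra rb s y z]bscC.
rewrite -(bigA_distr_bigA (fun i b => bsc1 pa pb s x i b * bsc1 ra rb s z i b)).
apply: eq_bigr => i _; rewrite sum_bsc1 /bsc1 /sel.
by case: (s i.1 == ord0); case: (x i); case: (z i); rewrite /= ?Ea ?Eb; ring.
Qed.

Section CrossoverProbabilities.
Variables (pa pb : R).
Hypotheses (pa0 : 0 <= pa) (pa1 : pa <= 1) (pb0 : 0 <= pb) (pb1 : pb <= 1).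

Lemma sel_ge0 k : 0 <= sel pa pb k.
Proof. by rewrite /sel; case: ifP. Qed.

Lemma sel_le1 k : sel pa pb k <= 1.
Proof. by rewrite /sel; case: ifP. Qed.

Lemma bsc1_ge0 s x i b : 0 <= bsc1 pa pb s x i b.
Proof. by rewrite /bsc1; case: ifP; rewrite ?subr_ge0 ?sel_ge0 ?sel_le1. Qed.

Lemma bsc_ge0 s x y : 0 <= bsc pa pb s x y.
Proof. by rewrite bscE prodr_ge0 // => i _; exact: bsc1_ge0. Qed.

Lemma bsc_ln s x y : bsc pa pb s x y != 0 ->
  ln (bsc pa pb s x y) = \sum_(i : 'I_B * 'I_N) ln (bsc1 pa pb s x i (y i)).
Proof.
rewrite bscE => /prodf_neq0 h; apply: ln_prod => i.
by rewrite lt_def h // bsc1_ge0.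
Qed.

Lemma sum_bsc1_ln s x i :
  \sum_b bsc1 pa pb s x i b * ln (bsc1 pa pb s x i b) = - hnat (sel pa pb (s i.1)).
Proof.
by rewrite sum_bsc1 /bsc1 eqxx; case: (x i) => /=; rewrite /hnat; lra.
Qed.

(** The logarithm is additive over positions. The value is the same for all [x], which is why the
    converse bound does not depend on the code. *)
Lemma bsc_negent s x :
  \sum_(y : word N B) bsc pa pb s x y * ln (bsc pa pb s x y) = - \sum_(i : 'I_B * 'I_N)
      hnat (sel pa pb (s i.1)).
Proof.
transitivity (\sum_(y : word N B) bsc pa pb s x y * \sum_(i : 'I_B * 'I_N) ln (bsc1 pa pb s
    x i (y i))).
  apply: eq_bigr => y _; have [->|W] := eqVneq (bsc pa pb s x y) 0.
    by rewrite !mul0r.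
  by rewrite bsc_ln.
under eq_bigr do rewrite mulr_sumr.
rewrite exchange_big /= -sumrN; apply: eq_bigr => i _.
by rewrite (prodw_expect1 (bsc1_sum1 pa pb s x) i (fun b => ln (bsc1 pa pb s x i b))) sum_bsc1_ln.
Qed.

Variable q1 : R.
Hypotheses (q0 : 0 <= q1) (q1le : q1 <= 1).

Lemma state_sum1 : \sum_k sel q1 (1 - q1) k = 1.
Proof. by rewrite big_ord_recl big_ord1 /sel /=; lra. Qed.

Lemma PS_ge0 s : 0 <= PS q1 s.
Proof.
by apply: prodr_ge0 => k _; rewrite /sel; case: ifP; rewrite ?subr_ge0.
Qed.

Lemma PS_sum1 : \sum_(s : stseq B) PS q1 s = 1.
Proof. exact: (prodw_sum1 (fun=> state_sum1)). Qed.

Lemma PS_mean (f : 'I_2 -> R) :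
  \sum_(s : stseq B) PS q1 s * \sum_(i : 'I_B * 'I_N) f (s i.1)
  = (N * B)%:R * (q1 * f ord0 + (1 - q1) * f ord_max).
Proof.
under eq_bigr do rewrite mulr_sumr.
rewrite exchange_big /= (eq_bigr (fun=> q1 * f ord0 + (1 - q1) * f ord_max)).
  by rewrite sumr_const card_prod !card_ord mulnC mulr_natl.
move=> i _; rewrite (prodw_expect1 (fun=> state_sum1)).
rewrite big_ord_recl big_ord1 /sel /=.
by congr (_ + _ * f _); apply: val_inj.
Qed.

(** Conditional entropy per symbol averaged over the fading state: adding it centres the
    log-likelihood of a symbol on average over states, not given the state. *)
Let hbar : R := q1 * hnat pa + (1 - q1) * hnat pb.

Lemma info_density_cross_le (c : R) s x i j :
  (forall k (b : bool), `|ln (if b then 1 - sel pa pb k else sel pa pb k) + hbar| <= c) ->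
  \sum_(y : word N B) bsc pa pb s x y * ((ln (bsc1 pa pb s x i (y i)) + hbar)
                          * (ln (bsc1 pa pb s x j (y j)) + hbar))
  <= c ^+ 2.
Proof.
move=> hc; rewrite -[leRHS]mul1r -(bsc_sum1 pa pb s x) mulr_suml.
apply: ler_sum => y _; apply: ler_wpM2l; first exact: bsc_ge0.
apply: (le_trans (ler_norm _)); rewrite normrM expr2.
by apply: ler_pM => //; apply: hc.
Qed.

Lemma bsc1_dev_mean s x i :
  \sum_b bsc1 pa pb s x i b * (ln (bsc1 pa pb s x i b) + hbar)
  = hbar - hnat (sel pa pb (s i.1)).
Proof.
under eq_bigr do rewrite mulrDr.
by rewrite big_split /= sum_bsc1_ln -mulr_suml bsc1_sum1 mul1r addrC.
Qed.

(** Given the states, distinct positions are independent, which leaves a product of conditional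
    means; states of distinct blocks are independent, so this product factors too, and each mean is
    0 by the choice of [hbar]. *)
Lemma info_density_cross x i j : i.1 != j.1 ->
  \sum_(s : stseq B) PS q1 s * \sum_(y : word N B) bsc pa pb s x y * ((ln (bsc1 pa pb s x i
      (y i)) + hbar)
                          * (ln (bsc1 pa pb s x j (y j)) + hbar)) = 0.
Proof.
move=> ij; transitivity (\sum_(s : stseq B) PS q1 s *
   ((hbar - hnat (sel pa pb (s i.1))) * (hbar - hnat (sel pa pb (s j.1))))).
  apply: eq_bigr => s _; congr (_ * _); rewrite -!(bsc1_dev_mean s x).
  apply: (@prodw_expect2 _ _ _ _ (bsc1_sum1 pa pb s x) i j
    (fun b => ln (bsc1 pa pb s x i b) + hbar) (fun b => ln (bsc1 pa pb s x j b) + hbar)).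
  by apply: contraNneq ij => ->.
rewrite (@prodw_expect2 _ _ _ _ (fun=> state_sum1) i.1 j.1
  (fun k => hbar - hnat (sel pa pb k)) (fun k => hbar - hnat (sel pa pb k))) //.
rewrite big_ord_recl big_ord1 /sel /= [X in X * _](_ : _ = 0) ?mul0r //.
by rewrite /hbar; ring.
Qed.

(* Fading couples only symbols of the same block, so the [B] blocks contribute
   at most [N ^ 2] terms each. *)
Lemma info_density_variance (c : R) x :
  (forall k (b : bool), `|ln (if b then 1 - sel pa pb k else sel pa pb k) + hbar| <= c) ->
  \sum_(s : stseq B) PS q1 s * \sum_(y : word N B) bsc pa pb s x y * (ln (bsc pa pb s x y)
      + (N * B)%:R * hbar) ^+ 2
  <= c ^+ 2 * (B * N ^ 2)%:R.
Proof.
move=> hc.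
pose g s (y : word N B) i := ln (bsc1 pa pb s x i (y i)) + hbar.
have -> : \sum_(s : stseq B) PS q1 s * \sum_(y : word N B) bsc pa pb s x y *
      (ln (bsc pa pb s x y) + (N * B)%:R * hbar) ^+ 2 =
    \sum_(i : 'I_B * 'I_N) \sum_(j : 'I_B * 'I_N) \sum_(s : stseq B) PS q1 s * \sum_(y :
        word N B) bsc pa pb s x y * (g s y i * g s y j).
  transitivity (\sum_(s : stseq B) \sum_(i : 'I_B * 'I_N) \sum_j
      PS q1 s * \sum_(y : word N B) bsc pa pb s x y * (g s y i * g s y j)).
    apply: eq_bigr => s _; under [RHS]eq_bigr do rewrite -mulr_sumr.
    rewrite -mulr_sumr; congr (_ * _).
    transitivity (\sum_(y : word N B) \sum_(i : 'I_B * 'I_N) \sum_(j : 'I_B * 'I_N) bsc pa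
        pb s x y * (g s y i * g s y j)).
      apply: eq_bigr => y _; under eq_bigr do rewrite -mulr_sumr.
      (* The logarithm splits into a sum only where no factor vanishes; outputs of probability 0
         carry no weight. *)
      rewrite -mulr_sumr; have [->|W] := eqVneq (bsc pa pb s x y) 0.
        by rewrite !mul0r.
      congr (_ * _); under eq_bigr do rewrite -mulr_sumr.
      rewrite -mulr_suml expr2; suff -> : ln (bsc pa pb s x y) + (N * B)%:R * hbar =
        \sum_(i : 'I_B * 'I_N) g s y i by [].
      rewrite big_split /= bsc_ln //; congr (_ + _).
      by rewrite sumr_const card_prod !card_ord mulnC mulr_natl.
    by rewrite exchange_big /=; apply: eq_bigr => i _; rewrite exchange_big.
  by rewrite exchange_big /=; apply: eq_bigr => i _; rewrite exchange_big.
apply: (@le_trans _ _ (\sum_(i : 'I_B * 'I_N) \sum_(j : 'I_B * 'I_N) (i.1 == j.1)%:R * c ^+ 2)).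
  apply: ler_sum => i _; apply: ler_sum => j _; case: eqP => [ij|/eqP ij]; last first.
    by rewrite mul0r info_density_cross.
  rewrite -(PS_sum1) mulr_suml; apply: ler_sum => s _.
  apply: ler_wpM2l; first exact: PS_ge0.
  exact: info_density_cross_le.
rewrite (eq_bigr (fun=> N%:R * c ^+ 2)) => [|i _].
  rewrite sumr_const card_prod !card_ord -[_ *+ (B * N)]mulr_natl mulrA -natrM mulrC.
  by rewrite expnS expn1 mulnA.
rewrite -mulr_suml; congr (_ * _).
rewrite -(pair_bigA _ (fun k (l : 'I_N) => (i.1 == k)%:R)) /=.
under eq_bigr do rewrite sumr_const card_ord.
rewrite (bigD1 i.1) //= eqxx big1 ?addr0 // => k /negPf ki.
by rewrite eq_sym ki mul0rn.
Qed.

End CrossoverProbabilities.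
End Channel.

(** * Mutual information and the converse *)

Definition negent (R : realType) (T : finType) (f : T -> R) : R :=
  \sum_t f t * ln (f t).

(** Composition of kernels. With a randomised encoder as first kernel it is the channel from
    messages to outputs. *)
Definition cascade (R : realType) (X Y Z : finType) (W : X -> Y -> R) (V : Y -> Z -> R)
    (x : X) (z : Z) : R := \sum_y W x y * V y z.

Definition output (R : realType) (X Y : finType) (P : X -> R) (W : X -> Y -> R)
    (y : Y) : R := \sum_x P x * W x y.

Definition mutinf (R : realType) (X Y : finType) (P : X -> R) (W : X -> Y -> R) : R :=
  \sum_x P x * \sum_y W x y * ln (W x y / output P W y).

Lemma output_cascade (R : realType) (X Y Z : finType) (P : X -> R)
    (W : X -> Y -> R) (V : Y -> Z -> R) z :
  output P (cascade W V) z = \sum_y output P W y * V y z.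
Proof.
rewrite /output /cascade; under eq_bigr do rewrite mulr_sumr.
rewrite exchange_big /=; apply: eq_bigr => y _; rewrite mulr_suml.
by apply: eq_bigr => x _; rewrite mulrA.
Qed.

Lemma cascadeA (R : realType) (X Y Z T : finType) (E : X -> Y -> R)
    (W : Y -> Z -> R) (V : Z -> T -> R) x t :
  cascade E (cascade W V) x t = cascade (cascade E W) V x t.
Proof. exact: (output_cascade (E x)). Qed.

Lemma cascade_ge0 (R : realType) (X Y Z : finType) (W : X -> Y -> R) (V : Y -> Z -> R) :
  (forall x y, 0 <= W x y) -> (forall y z, 0 <= V y z) -> forall x z, 0 <= cascade W V x z.
Proof. by move=> W0 V0 x z; apply: sumr_ge0 => y _; rewrite mulr_ge0. Qed.

Lemma cascade_sum1 (R : realType) (X Y Z : finType) (W : X -> Y -> R) (V : Y -> Z -> R) :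
  (forall x, \sum_y W x y = 1) -> (forall y, \sum_z V y z = 1) ->
  forall x, \sum_z cascade W V x z = 1.
Proof.
move=> W1 V1 x; rewrite exchange_big /= -[RHS](W1 x); apply: eq_bigr => y _.
by rewrite -mulr_sumr V1 mulr1.
Qed.

Section MutualInformation.
Variables (R : realType) (X Y : finType) (P : X -> R) (W : X -> Y -> R).
Hypotheses (P0 : forall x, 0 <= P x) (W0 : forall x y, 0 <= W x y).

Lemma output_ge0 y : 0 <= output P W y.
Proof. by apply: sumr_ge0 => x _; rewrite mulr_ge0. Qed.

Lemma output_eq0 x y : output P W y = 0 -> P x * W x y = 0.
Proof.
move=> /eqP; rewrite psumr_eq0 => [/allP h|x' _]; last by rewrite mulr_ge0.
by apply/eqP/h; rewrite mem_index_enum.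
Qed.

(** [I(X;Y) = H(Y) - H(Y|X)]: where [P x * W x y] is nonzero both arguments of the quotient are
    positive and its logarithm splits; elsewhere all terms vanish. *)
Lemma mutinf_negent :
  mutinf P W = \sum_x P x * negent (W x) - negent (output P W).
Proof.
transitivity (\sum_x P x * negent (W x) -
              \sum_x \sum_y P x * W x y * ln (output P W y)).
  rewrite -sumrB; apply: eq_bigr => x _; rewrite /negent !mulr_sumr -sumrB.
  apply: eq_bigr => y _; have [PW|PW] := eqVneq (P x * W x y) 0.
    by rewrite mulrA PW !mul0r mulrA PW mul0r subrr.
  have Wp : 0 < W x y.
    by rewrite lt_def W0 andbT; apply: contraNneq PW => ->; rewrite mulr0.
  have Op : 0 < output P W y.
    rewrite lt_def output_ge0 andbT; apply/eqP => /(@output_eq0 x) /eqP.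
    by rewrite (negPf PW).
  by rewrite ln_div ?posrE //; ring.
congr (_ - _); rewrite exchange_big /=; apply: eq_bigr => y _.
by rewrite -mulr_suml.
Qed.

Lemma mutinf_cascade (Z : finType) (V : Y -> Z -> R) :
  (forall y z, 0 <= V y z) -> (forall y, \sum_z V y z = 1) ->
  mutinf P (cascade W V) <= mutinf P W.
Proof.
(* Absolute continuity of [W x] with respect to the output law is guaranteed only for inputs of
   positive probability. *)
move=> V0 V1; apply: ler_sum => x _; have [->|Px] := eqVneq (P x) 0.
  by rewrite !mul0r.
apply: ler_wpM2l => //; under eq_bigr do rewrite output_cascade.
apply: kl_data_processing => // [y|y /(@output_eq0 x) /eqP]; first exact: output_ge0.
by rewrite mulf_eq0 (negPf Px) => /eqP.
Qed.

End MutualInformation.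

Lemma mutinf_ge0 (R : realType) (X Y : finType) (P : X -> R) (W : X -> Y -> R) :
  (forall x, 0 <= P x) -> (forall x y, 0 <= W x y) ->
  \sum_x P x = 1 -> (forall x, \sum_y W x y = 1) -> 0 <= mutinf P W.
Proof.
move=> P0 W0 P1 W1.
(* Processing the output down to a single point leaves mutual information 0, a lower bound by data
   processing. *)
pose V (_ : Y) (_ : unit) : R := 1.
have := @mutinf_cascade _ _ _ P W P0 W0 _ V (fun _ _ => ler01).
rewrite mutinf_negent // => [|x y]; last by apply: cascade_ge0.
have c1 x : cascade W V x = fun=> 1.
  by apply/funext => z; rewrite /cascade -mulr_suml W1 mulr1.
have o1 : output P (cascade W V) = fun=> 1.
  apply/funext => z; transitivity (\sum_x P x) => //.
  by apply: eq_bigr => x _; rewrite c1 mulr1.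
have n1 : negent (fun _ : unit => 1 : R) = 0.
  by apply: big1 => t _; rewrite ln1 mulr0.
rewrite o1 n1 big1 ?subrr => [|x _]; last by rewrite c1 n1 mulr0.
by apply => y; rewrite big_const card_unit /= addr0.
Qed.

(** A doubly stochastic kernel does not decrease entropy: this is data processing relative to the
    counting measure, which such a kernel preserves. *)
Lemma negent_mixing (R : realType) (Y Z : finType) (Q : Y -> R) (V : Y -> Z -> R) :
  (forall y, 0 <= Q y) -> (forall y z, 0 <= V y z) ->
  (forall y, \sum_z V y z = 1) -> (forall z, \sum_y V y z = 1) ->
  negent (fun z => \sum_y Q y * V y z) <= negent Q.
Proof.
move=> Q0 V0 V1 V1'.
have := @kl_data_processing _ _ _ Q (fun=> 1) V Q0 (fun=> ler01) _ V0 V1.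
under eq_bigr => z _ do rewrite -mulr_sumr V1' mulr1 divr1.
under [leRHS]eq_bigr do rewrite divr1.
by apply => y /eqP; rewrite oner_eq0.
Qed.

(** Both informations are differences of entropies. Mixing gives [H(Y) <= H(Z)], and data processing
    for each message, [I(X;Z|M=m) <= I(X;Y|M=m)], compares the conditional entropies. *)
Lemma wiretap_degraded (R : realType) (M X Y Z : finType) (P : M -> R)
    (E : M -> X -> R) (W : X -> Y -> R) (V : Y -> Z -> R) :
  (forall m, 0 <= P m) -> (forall m x, 0 <= E m x) -> (forall x y, 0 <= W x y) ->
  (forall y z, 0 <= V y z) ->
  (forall y, \sum_z V y z = 1) -> (forall z, \sum_y V y z = 1) ->
  mutinf P (cascade E W) - mutinf P (cascade E (cascade W V)) <=
  \sum_m P m * \sum_x E m x * (negent (W x) - negent (cascade W V x)).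
Proof.
move=> P0 E0 W0 V0 V1 V1'.
rewrite !mutinf_negent //; do ?exact: cascade_ge0; last exact/cascade_ge0/cascade_ge0.
have mix : negent (output P (cascade E (cascade W V))) <= negent (output P (cascade E W)).
  rewrite (_ : output P _ = fun z => \sum_y output P (cascade E W) y * V y z).
    by apply: negent_mixing => // y; apply: output_ge0 => //; exact: cascade_ge0.
  apply/funext => z; rewrite -output_cascade.
  by apply: eq_bigr => m _; rewrite cascadeA.
have dp : \sum_m P m * negent (cascade E W m) - \sum_m P m * negent (cascade E (cascade W V) m)
    <= \sum_m P m * \sum_x E m x * (negent (W x) - negent (cascade W V x)).
  rewrite -sumrB; apply: ler_sum => m _; rewrite -mulrBr ler_wpM2l //.
  have := @mutinf_cascade _ _ _ (E m) W (E0 m) W0 _ V V0 V1.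
  rewrite !mutinf_negent //; last exact: cascade_ge0.
  under [X in _ -> _ <= X]eq_bigr do rewrite mulrBr.
  rewrite sumrB.
  rewrite -[output (E m) W]/(cascade E W m) -[output (E m) (cascade W V)]/(cascade E
      (cascade W V) m).
  by lra.
by lra.
Qed.

Lemma fano (R : realType) (M : nat) (Y : finType) (U : 'I_M -> Y -> R) (d : Y -> 'I_M) :
  (0 < M)%N -> (forall m y, 0 <= U m y) -> (forall m, \sum_y U m y = 1) ->
  (1 - \sum_m M%:R^-1 * \sum_y U m y * (d y != m)%:R) * ln M%:R - ln 2
  <= mutinf (fun=> M%:R^-1) U.
Proof.
move=> M0 U0 U1.
have Mp : 0 < M%:R :> R by rewrite ltr0n.
have Mn : M%:R != 0 :> R by rewrite gt_eqF.
have Mi : 0 <= M%:R^-1 :> R by rewrite invr_ge0 ltW.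
have sM : \sum_(m < M) M%:R^-1 = 1 :> R.
  by rewrite sumr_const card_ord -[_ *+ M]mulr_natl divff.
pose Q := output (fun=> M%:R^-1) U.
pose a (t : 'I_M * Y) := M%:R^-1 * U t.1 t.2.
pose b (t : 'I_M * Y) := M%:R^-1 * Q t.2.
(* Trial density favouring correctly decoded pairs. Under the product law [b] a guess is right with
   probability [1 / M], so right and wrong pairs each contribute at most 1/2 to the mass of
   [c * b]. *)
pose c (t : 'I_M * Y) : R := (if d t.2 == t.1 then M%:R else 1) / 2.
have -> : mutinf (fun=> M%:R^-1) U = \sum_t a t * ln (a t / b t).
  rewrite -(pair_bigA _ (fun m y => a (m, y) * ln (a (m, y) / b (m, y)))) /=.
  apply: eq_bigr => m _; rewrite mulr_sumr; apply: eq_bigr => y _.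
  by rewrite /a /b /= -mulf_div divff ?invr_eq0 // mul1r mulrA.
have sa : \sum_t a t = 1.
  rewrite -(pair_bigA _ (fun m y => a (m, y))) /= -[RHS]sM.
  by apply: eq_bigr => m _; rewrite /a /= -mulr_sumr U1 mulr1.
have -> : (1 - \sum_m M%:R^-1 * \sum_y U m y * (d y != m)%:R) * ln M%:R - ln 2
    = \sum_t a t * ln (c t).
  have lc t : ln (c t) = ln M%:R - (d t.2 != t.1)%:R * ln M%:R - ln 2.
    rewrite /c ln_div ?posrE //; last by case: ifP.
    by case: eqP => _ /=; rewrite ?ln1; ring.
  under [RHS]eq_bigr do rewrite lc -{1}[ln M%:R]mul1r -mulrBl mulrBr mulrA mulrBr mulr1.
  rewrite sumrB -!mulr_suml sumrB sa mul1r; congr ((1 - _) * _ - _).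
  rewrite -(pair_bigA _ (fun m y => a (m, y) * (d y != m)%:R)) /=.
  by apply: eq_bigr => m _; rewrite mulr_sumr; apply: eq_bigr => y _; rewrite mulrA.
apply: gibbs => [t|t|t|t|].
- by rewrite mulr_ge0.
- by rewrite mulr_ge0 // output_ge0.
- move/eqP; rewrite mulf_eq0 invr_eq0 (negPf Mn) /= => /eqP.
  exact: (@output_eq0 _ _ _ _ _ (fun=> Mi) U0 t.1).
- by rewrite /c divr_gt0 //; case: ifP.
rewrite sa -(pair_bigA _ (fun m y => c (m, y) * b (m, y))) /= exchange_big /=.
have sQ : \sum_y Q y = 1.
  by rewrite exchange_big /= -[RHS]sM; apply: eq_bigr => m _; rewrite -mulr_sumr U1 mulr1.
rewrite -[leRHS]sQ; apply: ler_sum => y _; rewrite /b /=.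
rewrite (eq_bigr (fun m => c (m, y) / M%:R * Q y)) => [|m _]; last by rewrite mulrA.
rewrite -mulr_suml -[leRHS]mul1r ler_wpM2r ?output_ge0 //.
rewrite (bigD1 (d y)) //= /c /= eqxx.
rewrite (_ : M%:R / 2 / M%:R = 2^-1); last by field.
apply: (@le_trans _ _ (2^-1 + 2^-1 * \sum_(m < M) M%:R^-1)).
  rewrite lerD2l mulr_sumr [leRHS](bigD1 (d y)) //= -[leLHS]add0r lerD //.
    by rewrite mulr_ge0 ?invr_ge0 ?ler0n.
  by apply: ler_sum => m /negPf dm; rewrite eq_sym dm mul1r.
by rewrite sM; lra.
Qed.

Section CodeConverse.
Variables (R : realType) (q1 p1 p2 ps1 ps2 : R) (N B : nat) (c : Defs.code R N B).

Lemma err_probE : err_prob q1 p1 p2 c = \sum_(s : stseq B) PS q1 s *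
  \sum_m (msize c)%:R^-1 * \sum_y cascade (@enc _ _ _ c) (bsc p1 p2 s) m y * (dec c y s != m)%:R.
Proof.
apply: eq_bigr => s _; congr (_ * _); apply: eq_bigr => m _; congr (_ * _).
under [RHS]eq_bigr do rewrite mulr_suml.
rewrite [RHS]exchange_big /=; apply: eq_bigr => x _; rewrite mulr_sumr.
by apply: eq_bigr => y _; rewrite mulrA.
Qed.

(** The message probability cancels inside the logarithm, and division by [ln 2] converts nats to
    bits. *)
Lemma leakageE : leakage q1 ps1 ps2 c = (\sum_(s : stseq B) PS q1 s *
  mutinf (fun=> (msize c)%:R^-1) (cascade (@enc _ _ _ c) (bsc ps1 ps2 s))) / ln 2.
Proof.
have Mn : (msize c)%:R^-1 != 0 :> R by rewrite invr_eq0 pnatr_eq0 -lt0n msize_gt0.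
rewrite mulr_suml; apply: eq_bigr => s _; rewrite -mulrA; congr (_ * _).
rewrite mulr_suml; apply: eq_bigr => m _; rewrite mulr_sumr mulr_suml.
apply: eq_bigr => z _ /=.
rewrite -[pMZ ps1 ps2 s m z]/((msize c)%:R^-1 * cascade (@enc _ _ _ c) (bsc ps1 ps2 s) m z).
rewrite -[pZ ps1 ps2 c s z]/(output (fun=> (msize c)%:R^-1) (cascade (@enc _ _ _ c) (bsc
    ps1 ps2 s)) z).
rewrite -mulf_div divff // mul1r /log2 !mulrA.
by case: eqP => // ->; rewrite !mul0r.
Qed.

(** Solving for [r] gives [(ps - p) / (1 - 2 * p)], at most 1 because [ps + p <= 1]. For [p = 1/2]
    the hypotheses force [ps = p], and [r = 0] serves. *)
Lemma bsc_degraded_param (p ps : R) : 0 <= p -> p <= ps -> ps <= 2^-1 ->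
  exists2 r : R, 0 <= r <= 1 & ps = p * (1 - r) + (1 - p) * r.
Proof.
move=> p0 pps psh; have [ph|ph] := eqVneq p 2^-1.
  by exists 0; [rewrite lexx ler01|rewrite subr0 mulr0 addr0 mulr1; lra].
have d0 : 0 < 1 - 2 * p.
  have plt : p < 2^-1 by rewrite lt_neqAle ph (le_trans pps).
  by lra.
have dn : 1 - 2 * p != 0 by rewrite gt_eqF.
exists ((ps - p) / (1 - 2 * p)); last by field.
apply/andP; split; first by apply: divr_ge0; lra.
by rewrite ler_pdivrMr // mul1r; lra.
Qed.

(** For each state sequence Fano's inequality bounds [I(M;Y)] from below and degradedness bounds
    [I(M;Y) - I(M;Z)] from above; averaging over the states concludes. *)
Lemma code_converse :
  0 <= q1 -> q1 <= 1 ->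
  0 <= p1 -> p1 <= ps1 -> ps1 <= 2^-1 ->
  0 <= p2 -> p2 <= ps2 -> ps2 <= 2^-1 ->
  (1 - err_prob q1 p1 p2 c) * ln (msize c)%:R - ln 2 <=
  leakage q1 ps1 ps2 c * ln 2 +
  (N * B)%:R * (q1 * (hnat ps1 - hnat p1) + (1 - q1) * (hnat ps2 - hnat p2)).
Proof.
move=> q0 qle p10 p1s ps1h p20 p2s ps2h.
have p1le : p1 <= 1 by lra.
have p2le : p2 <= 1 by lra.
have ps10 : 0 <= ps1 by lra.
have ps20 : 0 <= ps2 by lra.
have ps1le : ps1 <= 1 by lra.
have ps2le : ps2 <= 1 by lra.
have [r1 /andP[r10 r11] e1] := bsc_degraded_param p10 p1s ps1h.
have [r2 /andP[r20 r21] e2] := bsc_degraded_param p20 p2s ps2h.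
have Mi : 0 <= (msize c)%:R^-1 :> R by rewrite invr_ge0 ler0n.
have lnM : (1 - err_prob q1 p1 p2 c) * ln (msize c)%:R - ln 2 =
  \sum_(s : stseq B) PS q1 s * ((1 - \sum_m (msize c)%:R^-1 *
     \sum_y cascade (@enc _ _ _ c) (bsc p1 p2 s) m y * (dec c y s != m)%:R) * ln (msize
         c)%:R - ln 2).
  under [RHS]eq_bigr do rewrite mulrBr mulrA mulrBr mulr1.
  by rewrite sumrB -!mulr_suml sumrB PS_sum1 // mul1r -err_probE.
rewrite lnM leakageE divfK ?gt_eqF ?ln2_gt0 //.
pose f k := hnat (sel ps1 ps2 k) - hnat (sel p1 p2 k).
have <- : \sum_(s : stseq B) PS q1 s * \sum_(i : 'I_B * 'I_N) f (s i.1) =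
   (N * B)%:R * (q1 * (hnat ps1 - hnat p1) + (1 - q1) * (hnat ps2 - hnat p2)).
  exact: PS_mean.
rewrite -big_split /=; apply: ler_sum => s _; rewrite -mulrDr ler_wpM2l ?PS_ge0 //.
have W0 (x y : word N B) : 0 <= bsc p1 p2 s x y by exact: bsc_ge0.
have V0 (x y : word N B) : 0 <= bsc r1 r2 s x y by exact: bsc_ge0.
have V1 (x : word N B) : \sum_y bsc r1 r2 s x y = 1 by exact: bsc_sum1.
have V1' (y : word N B) : \sum_x bsc r1 r2 s x y = 1.
  by rewrite -[RHS](V1 y); apply: eq_bigr => x _; rewrite bscC.
apply: (le_trans (fano (fun y => dec c y s) (msize_gt0 c) _ _)).
- by apply: cascade_ge0 => // m x; exact: enc_ge0.
- by apply: cascade_sum1 => [m|x]; [exact: enc_sum1|exact: bsc_sum1].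
have WV : cascade (bsc p1 p2 (N := N) s) (bsc r1 r2 s) = bsc ps1 ps2 s.
  by apply: funext => x; apply: funext => z; exact: bsc_cascade.
have := @wiretap_degraded _ _ _ _ _ (fun=> (msize c)%:R^-1) (@enc _ _ _ c)
  (bsc p1 p2 s) (bsc r1 r2 s) (fun=> Mi) (@enc_ge0 _ _ _ c) W0 V0 V1 V1'.
rewrite WV lerBlDl => /le_trans; apply; rewrite lerD2l.
(* The entropy gap is the same for every codeword, so the averages over codewords and messages
   disappear. *)
rewrite (eq_bigr (fun=> (msize c)%:R^-1 * \sum_(i : 'I_B * 'I_N) f (s i.1))).
  by rewrite sumr_const card_ord -[_ *+ msize c]mulr_natl mulrA divff ?mul1r //
    pnatr_eq0 -lt0n msize_gt0.
move=> m _; congr (_ * _); rewrite -[RHS]mul1r -[in RHS](enc_sum1 m) mulr_suml.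
apply: eq_bigr => x _; congr (_ * _).
by rewrite /negent !bsc_negent // /f [RHS]sumrB opprK addrC.
Qed.

End CodeConverse.

(** * Random codebooks *)

Lemma exists_le_mean (R : realType) (T : finType) (mu f : T -> R) (b : R) :
  (forall t, 0 <= mu t) -> \sum_t mu t = 1 -> \sum_t mu t * f t <= b ->
  exists t, f t <= b.
Proof.
move=> mu0 mu1 fb; apply: contrapT => /forallNP h.
have fgt t : b < f t by rewrite ltNge; apply/negP/h.
have /eqP : \sum_t mu t * (f t - b) = 0.
  apply/eqP; rewrite eq_le; apply/andP; split.
    by under eq_bigr do rewrite mulrBr; rewrite sumrB -mulr_suml mu1 mul1r subr_le0.
  by apply: sumr_ge0 => t _; rewrite mulr_ge0 // subr_ge0 ltW.
rewrite psumr_eq0 => [/allP z|t _]; last by rewrite mulr_ge0 // subr_ge0 ltW.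
move: mu1; rewrite big1 => [/eqP|t _]; first by rewrite eq_sym oner_eq0.
have := z t; rewrite mem_index_enum => /(_ isT).
by rewrite mulf_eq0 subr_eq0 [f t == b]gt_eqF // orbF => /eqP.
Qed.

Section RandomCodebook.
Variables (R : realType) (X Y I : finType) (W : X -> Y -> R).
Hypotheses (W0 : forall x y, 0 <= W x y).
Hypothesis Wr : forall x, \sum_y W x y = 1.
Hypothesis Wc : forall y, \sum_x W x y = 1.
Hypothesis X0 : (0 < #|X|)%N.

Let D : R := #|X|%:R.

(** Law of a codebook of independent uniform codewords. The constant weight is kept as a product so
    that the product-measure expectations apply. *)
Definition cbw (c : {ffun I -> X}) : R := \prod_(i : I) #|X|%:R^-1.

Let D0 : 0 < D. Proof. by rewrite ltr0n. Qed.
Let Dn : D != 0. Proof. by rewrite gt_eqF. Qed.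

Lemma unif_sum1 : \sum_(x : X) D^-1 = 1.
Proof. by rewrite sumr_const -[_ *+ _]mulr_natl divff. Qed.

Lemma cbw_ge0 c : 0 <= cbw c.
Proof. by apply: prodr_ge0 => i _; rewrite invr_ge0 ler0n. Qed.

Lemma cbw_sum1 : \sum_c cbw c = 1.
Proof. exact: (prodw_sum1 (fun=> unif_sum1)). Qed.

Lemma cbw_expect1 (i : I) (u : X -> R) :
  \sum_c cbw c * u (c i) = D^-1 * \sum_x u x.
Proof. by rewrite mulr_sumr; exact: (prodw_expect1 (fun=> unif_sum1)). Qed.

Lemma cbw_expect2 (i j : I) (u v : X -> R) : i != j ->
  \sum_c cbw c * (u (c i) * v (c j)) = (D^-1 * \sum_x u x) * (D^-1 * \sum_x v x).
Proof.
by move=> ij; rewrite (prodw_expect2 (fun=> unif_sum1) u v ij) -!mulr_sumr.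
Qed.

Section SoftCovering.
Variables (L : nat) (h : 'I_L -> I).
Hypotheses (L0 : (0 < L)%N) (h_inj : injective h).

Let Lp : 0 < L%:R :> R. Proof. by rewrite ltr0n. Qed.

(** Output law when one of the [L] codewords selected by [h] is sent uniformly at random. *)
Definition cb_output (c : {ffun I -> X}) (y : Y) : R := L%:R^-1 * \sum_l W (c (h l)) y.

Lemma cb_output_ge0 c y : 0 <= cb_output c y.
Proof. by rewrite mulr_ge0 ?invr_ge0 ?ler0n ?sumr_ge0. Qed.

Lemma cb_output_sum1 c : \sum_y cb_output c y = 1.
Proof.
rewrite -mulr_sumr exchange_big /= (eq_bigr (fun=> 1)) => [|l _]; last exact: Wr.
by rewrite sumr_const card_ord mulVf // gt_eqF.
Qed.

(** Upper bound on the conditional mean of [D * cb_output c y] given [c (h l) = x]: that codeword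
    contributes [D * W x y / L], the other [L - 1] together at most 1, since the columns of [W] sum
    to 1. *)
Let a y x : R := 1 + D * W x y / L%:R.
Let g y x : R := W x y / a y x.

Let a_gt0 y x : 0 < a y x.
Proof. by rewrite ltr_wpDr // divr_ge0 ?mulr_ge0 // ltW. Qed.

Let g_ge0 y x : 0 <= g y x. Proof. by rewrite divr_ge0 // ltW. Qed.

(* Tangent-line form of Jensen's inequality, at the conditional mean [a] of
   the normalised output given the codeword [c (h l)]. *)
Let tangent_bound c y : cb_output c y * ln (D * cb_output c y) <=
  L%:R^-1 * \sum_l (W (c (h l)) y * ln (a y (c (h l))) - g y (c (h l)) +
     D / L%:R * \sum_(k | k != l) g y (c (h l)) * W (c (h k)) y).
Proof.
rewrite {1}/cb_output -mulrA ler_wpM2l ?invr_ge0 ?(ltW Lp) // mulr_suml.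
apply: ler_sum => l _; set w := W (c (h l)) y; have [w0|wn] := eqVneq w 0.
  rewrite w0 !mul0r add0r {1}/g -/w w0 mul0r oppr0 add0r.
  by rewrite mulr_ge0 ?divr_ge0 ?(ltW D0) ?(ltW Lp) // sumr_ge0 // => k _; rewrite mulr_ge0.
have wp : 0 < w by rewrite lt_def wn W0.
have Op : 0 < cb_output c y.
  rewrite mulr_gt0 ?invr_gt0 // (bigD1 l) //= ltr_wpDr // sumr_ge0 //.
have Lpp := Lp; have app := a_gt0 y (c (h l)).
have Ln : L%:R != 0 :> R by rewrite gt_eqF.
have an : a y (c (h l)) != 0 by rewrite gt_eqF.
have DOp : 0 < D * cb_output c y by exact: mulr_gt0.
have := ln_le_subr1 (divr_gt0 DOp app).
rewrite ln_div ?posrE // => /(ler_wpM2l (ltW wp)).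
have E1 : D * cb_output c y = (a y (c (h l)) - 1) + D / L%:R * \sum_(k | k != l) W (c (h k)) y.
  by rewrite /cb_output /a (bigD1 l) //= -/w; field.
rewrite -mulr_sumr /g -/w mulrBr [X in _ <= X -> _](_ : _ =
  - (w / a y (c (h l))) + D / L%:R * (w / a y (c (h l)) * \sum_(k | k != l) W (c (h k)) y)).
  by lra.
by rewrite E1; field; rewrite an Ln.
Qed.

Lemma soft_covering :
  \sum_c cbw c * \sum_y cb_output c y * ln (D * cb_output c y) <=
  D^-1 * \sum_x \sum_y W x y * ln (1 + D * W x y / L%:R).
Proof.
under eq_bigr do rewrite mulr_sumr.
rewrite exchange_big /= [X in _ * X]exchange_big /= mulr_sumr.
apply: ler_sum => y _.
apply: (@le_trans _ _ (L%:R^-1 * \sum_l (\sum_c cbw c * (W (c (h l)) y * ln (a y (c (h l))))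
   - \sum_c cbw c * g y (c (h l)) +
     D / L%:R * \sum_(k | k != l) \sum_c cbw c * (g y (c (h l)) * W (c (h k)) y)))).
  apply: (@le_trans _ _ (\sum_c cbw c * (L%:R^-1 * \sum_l (W (c (h l)) y * ln (a y (c (h
      l))) - g y (c (h l)) +
     D / L%:R * \sum_(k | k != l) g y (c (h l)) * W (c (h k)) y)))).
    by apply: ler_sum => c _; rewrite ler_wpM2l ?cbw_ge0.
  under eq_bigr do rewrite mulrCA mulr_sumr.
  rewrite -mulr_sumr exchange_big /= le_eqVlt; apply/orP; left; apply/eqP.
  congr (_ * _); apply: eq_bigr => l _.
  rewrite exchange_big /= -sumrB mulr_sumr -big_split /=; apply: eq_bigr => c _.
  by rewrite -[in RHS]mulr_sumr; ring.
(* The linear terms have nonpositive mean: with [G] the mean of [g], independence of distinct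
   codewords makes each cross term [G / D], and fewer than [L] of them, scaled by [D / L], do not
   exceed [G]. *)
apply: (@le_trans _ _ (L%:R^-1 * \sum_(l < L) (D^-1 * \sum_x W x y * ln (a y x)))).
  rewrite ler_wpM2l ?invr_ge0 ?(ltW Lp) //; apply: ler_sum => l _.
  rewrite (cbw_expect1 (h l) (fun x => W x y * ln (a y x))).
  rewrite (cbw_expect1 (h l) (g y)).
  set G := D^-1 * \sum_x g y x.
  have G0 : 0 <= G by rewrite mulr_ge0 ?sumr_ge0 // invr_ge0 ltW.
  rewrite [X in _ + _ * X](_ : _ = \sum_(k < L | k != l) G * D^-1); last first.
    apply: eq_bigr => k kl.
    have hlk : h l != h k by rewrite (inj_eq h_inj) eq_sym.
    by rewrite (cbw_expect2 (g y) (fun x => W x y) hlk) Wc mulr1.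
  rewrite sumr_const -[(G / D) *+ _]mulr_natr -addrA gerDl addrC subr_le0.
  set K := #|_|; have KL : (K <= L)%N by rewrite -[leqRHS]card_ord max_card.
  have -> : D / L%:R * (G / D * K%:R) = G * (K%:R / L%:R).
    by field; rewrite Dn gt_eqF.
  by rewrite -[leRHS]mulr1 ler_wpM2l // ler_pdivrMr // mul1r ler_nat.
by rewrite sumr_const card_ord -[(_ * _) *+ L]mulr_natl mulKf ?gt_eqF.
Qed.

End SoftCovering.

Section ThresholdDecoding.
Variables (i0 : I) (t : R).
Hypothesis t0 : 0 < t.

(** Uniform inputs give every output probability [1 / D], so the test says that the information
    density exceeds [ln t]. The default [i0] is returned when no index passes. *)
Definition threshold_dec (c : {ffun I -> X}) (y : Y) : I :=
  odflt i0 [pick i | t < D * W (c i) y].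

(** Union bound: an error requires the true index to fail the test or a wrong one to pass it. *)
Lemma threshold_dec_error c y i : (threshold_dec c y != i)%:R <=
  (D * W (c i) y <= t)%R%:R + \sum_(k | k != i) (t < D * W (c k) y)%R%:R :> R.
Proof.
have s0 : 0 <= \sum_(k | k != i) (t < D * W (c k) y)%R%:R :> R by rewrite sumr_ge0.
have [ti|it] := leP (D * W (c i) y) t.
  by case: (threshold_dec c y == i) => /=; lra.
rewrite add0r /threshold_dec; case: pickP => [k tk|/(_ i)] /=; last by rewrite it.
have [_|ki] := eqVneq k i; first by rewrite sumr_ge0.
by rewrite (bigD1 k) //= tk lerDl sumr_ge0.
Qed.

Lemma threshold_decoding (i : I) :
  \sum_c cbw c * \sum_y W (c i) y * (threshold_dec c y != i)%:R <=
  D^-1 * (\sum_x \sum_y W x y * (D * W x y <= t)%R%:R) + #|I|%:R / t.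
Proof.
(* Markov's inequality: a uniform codeword independent of [y] passes the test with probability at
   most [1 / t]. *)
have hit y : D^-1 * \sum_x (t < D * W x y)%R%:R <= t^-1.
  apply: (@le_trans _ _ (D^-1 * \sum_x D / t * W x y)).
    rewrite ler_wpM2l ?invr_ge0 ?ler0n //; apply: ler_sum => x _.
    have [tx|_] /= := ltP; last by rewrite mulr_ge0 // divr_ge0 ?ltW.
    by rewrite mulrAC ler_pdivlMr // mul1r ltW.
  by rewrite -mulr_sumr Wc mulr1 mulrA mulVf // mul1r.
under eq_bigr do rewrite mulr_sumr.
rewrite exchange_big /= [X in _ * X + _]exchange_big /= mulr_sumr.
(* Spread over the output law, so that both sides can be compared for each [y]. *)
have -> : #|I|%:R / t = \sum_y D^-1 * (\sum_x W x y) * (#|I|%:R / t).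
  by rewrite -mulr_suml -mulr_sumr exchange_big /= (eq_bigr (fun=> 1)) ?sumr_const ?mulVf ?mul1r.
rewrite -big_split /=; apply: ler_sum => y _.
apply: (@le_trans _ _ (\sum_c cbw c * (W (c i) y * (D * W (c i) y <= t)%R%:R) +
    \sum_(k | k != i) \sum_c cbw c * (W (c i) y * (t < D * W (c k) y)%R%:R))).
  rewrite exchange_big /= -big_split /=; apply: ler_sum => c _.
  rewrite -!mulr_sumr -!mulrDr ler_wpM2l ?cbw_ge0 // ler_wpM2l //.
  exact: threshold_dec_error.
rewrite (cbw_expect1 i (fun x => W x y * (D * W x y <= t)%R%:R)) lerD2l.
apply: (@le_trans _ _ (\sum_(k : I) D^-1 * (\sum_x W x y) * t^-1)).
  rewrite [leRHS](bigD1 i) //= -[leLHS]add0r lerD //.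
    by rewrite !mulr_ge0 ?invr_ge0 ?sumr_ge0 ?ltW.
  apply: ler_sum => k ki.
  rewrite (cbw_expect2 (fun x => W x y) (fun x => (t < D * W x y)%R%:R)) 1?eq_sym //.
  by rewrite ler_wpM2l // mulr_ge0 ?invr_ge0 ?sumr_ge0 ?ltW.
by rewrite sumr_const -[(_ * _) *+ _]mulr_natl mulrCA.
Qed.

End ThresholdDecoding.

End RandomCodebook.

(** * Wiretap codes from codebooks *)

(** Entropy is at most the logarithm of the alphabet size: Gibbs against the counting measure with
    the constant trial density [1 / #|T|]. *)
Lemma negent_ge (R : realType) (T : finType) (f : T -> R) :
  (0 < #|T|)%N -> (forall t, 0 <= f t) -> \sum_t f t = 1 -> - ln #|T|%:R <= negent f.
Proof.
move=> T0 f0 f1; have Tp : 0 < #|T|%:R :> R by rewrite ltr0n.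
have : \sum_t f t * ln #|T|%:R^-1 <= \sum_t f t * ln (f t / 1).
  apply: (@gibbs _ T f (fun=> 1) (fun=> #|T|%:R^-1)) => // [t /eqP|t|].
  - by rewrite oner_eq0.
  - by rewrite invr_gt0.
  by rewrite f1 mulr1 sumr_const -[(_^-1) *+ _]mulr_natl divff // gt_eqF.
rewrite -mulr_suml f1 mul1r lnV ?posrE // => /le_trans; apply.
by apply: ler_sum => t _; rewrite divr1.
Qed.

Section CodebookCode.
Variables (R : realType) (N B M L : nat).
Hypotheses (M0 : (0 < M)%N) (L0 : (0 < L)%N).
Variables (p1 p2 ps1 ps2 t : R) (i0 : 'I_M * 'I_L).

Let Mn : M%:R != 0 :> R. Proof. by rewrite pnatr_eq0 -lt0n. Qed.
Let Ln : L%:R != 0 :> R. Proof. by rewrite pnatr_eq0 -lt0n. Qed.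

Definition row_index (m : 'I_M) (l : 'I_L) : 'I_M * 'I_L := (m, l).

(** A uniform column of row [m] is sent, its random index serving to confuse the eavesdropper.
    Repeated codewords are counted with multiplicity. *)
Definition cb_enc (cb : {ffun 'I_M * 'I_L -> word N B}) (m : 'I_M) :
  {ffun word N B -> R} := [ffun x => L%:R^-1 * \sum_l (x == cb (row_index m l))%:R].

Lemma cb_enc_ge0 cb m x : 0 <= cb_enc cb m x.
Proof. by rewrite ffunE mulr_ge0 ?invr_ge0 ?ler0n ?sumr_ge0. Qed.

Lemma cb_enc_sum1 cb m : \sum_x cb_enc cb m x = 1.
Proof.
under eq_bigr do rewrite ffunE.
rewrite -mulr_sumr exchange_big /= (eq_bigr (fun=> 1)) => [|l _].
  by rewrite sumr_const card_ord mulVf.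
by rewrite (bigD1 (cb (row_index m l))) //= eqxx big1 ?addr0 // => x /negPf ->.
Qed.

(** The pair of message and randomisation index is decoded, then the index is dropped; a message
    error is thus a pair error. *)
Definition cb_dec (cb : {ffun 'I_M * 'I_L -> word N B}) (y : word N B) (s : stseq B) : 'I_M :=
  (threshold_dec (bsc p1 p2 s) i0 t cb y).1.

Definition cb_code (cb : {ffun 'I_M * 'I_L -> word N B}) : Defs.code R N B :=
  Code M0 (cb_enc_ge0 cb) (cb_enc_sum1 cb) (cb_dec cb).

Lemma cascade_cb_enc cb (W : word N B -> word N B -> R) m :
  cascade (cb_enc cb) W m = cb_output W (row_index m) cb.
Proof.
apply/funext => y; rewrite /cascade /cb_output.
under eq_bigr do rewrite ffunE -mulrA mulr_suml.
rewrite -mulr_sumr exchange_big /=; congr (_ * _); apply: eq_bigr => l _.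
rewrite (bigD1 (cb (row_index m l))) //= eqxx mul1r big1 ?addr0 // => x /negPf ->.
by rewrite mul0r.
Qed.

Variable q1 : R.
Hypotheses (q0 : 0 <= q1) (qle : q1 <= 1).
Hypotheses (p10 : 0 <= p1) (p1l : p1 <= 1) (p20 : 0 <= p2) (p2l : p2 <= 1).
Hypotheses (ps10 : 0 <= ps1) (ps1l : ps1 <= 1) (ps20 : 0 <= ps2) (ps2l : ps2 <= 1).

Lemma cb_err_prob_le cb : err_prob q1 p1 p2 (cb_code cb) <=
  \sum_(s : stseq B) PS q1 s * \sum_(i : 'I_M * 'I_L) #|{: 'I_M * 'I_L}|%:R^-1 *
    \sum_y bsc p1 p2 s (cb i) y * (threshold_dec (bsc p1 p2 s) i0 t cb y != i)%:R.
Proof.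
rewrite err_probE; apply: ler_sum => s _; rewrite ler_wpM2l ?PS_ge0 //.
have pairE (F : 'I_M * 'I_L -> R) : \sum_i F i = \sum_m \sum_l F (m, l).
  by rewrite pair_bigA /=; apply: eq_bigr => -[].
rewrite pairE.
apply: ler_sum => m _; under eq_bigr do rewrite cascade_cb_enc /cb_output -mulrA mulr_suml.
rewrite -mulr_sumr -mulr_sumr mulrA card_prod !card_ord natrM invfM.
rewrite ler_wpM2l ?mulr_ge0 ?invr_ge0 ?ler0n // exchange_big /=.
apply: ler_sum => l _; apply: ler_sum => y _; rewrite ler_wpM2l ?bsc_ge0 //.
rewrite ler_nat /cb_dec; case: (threshold_dec _ _ _ _ _) => m' l' /=.
by rewrite xpair_eqE; case: (m' == m).
Qed.

(** Bounding the output entropy by [ln D] replaces [I(M;Z)] by the mean divergence of the row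
    outputs from the uniform law, the quantity that soft covering controls. *)
Lemma cb_leakage_le cb : leakage q1 ps1 ps2 (cb_code cb) * ln 2 <=
  \sum_(s : stseq B) PS q1 s * \sum_m M%:R^-1 *
    \sum_z cb_output (bsc ps1 ps2 s) (row_index m) cb z *
       ln (#|{: word N B}|%:R * cb_output (bsc ps1 ps2 s) (row_index m) cb z).
Proof.
rewrite leakageE divfK ?gt_eqF ?ln2_gt0 //.
apply: ler_sum => s _; rewrite ler_wpM2l ?PS_ge0 //.
set W := bsc ps1 ps2 s; set D := #|_|.
have W0 x y : 0 <= W x y by exact: bsc_ge0.
have W1 x : \sum_y W x y = 1 by exact: bsc_sum1.
have D0 : (0 < D)%N by apply/card_gt0P; exists [ffun=> false].
have Dp : 0 < D%:R :> R by rewrite ltr0n.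
have O0 m z : 0 <= cb_output W (row_index m) cb z by exact: cb_output_ge0.
have O1 m : \sum_z cb_output W (row_index m) cb z = 1 by exact: cb_output_sum1.
have C0 : forall m z, 0 <= cascade (cb_enc cb) W m z by move=> m z; rewrite cascade_cb_enc.
have Mi : 0 <= M%:R^-1 :> R by rewrite invr_ge0.
have sM : \sum_(m < M) M%:R^-1 = 1 :> R.
  by rewrite sumr_const card_ord -[(_^-1) *+ M]mulr_natl divff.
rewrite mutinf_negent //=.
apply: (@le_trans _ _ (\sum_(m < M) M%:R^-1 * negent (cascade (cb_enc cb) W m) + ln D%:R)).
  rewrite lerD2l lerNl; apply: negent_ge => // [z|]; first exact: output_ge0.
  rewrite exchange_big /= -[RHS]sM; apply: eq_bigr => m _.
  by rewrite -mulr_sumr cascade_cb_enc O1 mulr1.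
have -> : ln D%:R = \sum_(m < M) M%:R^-1 * ln D%:R :> R by rewrite -mulr_suml sM mul1r.
rewrite -big_split /=; apply: ler_sum => m _; rewrite -mulrDr ler_wpM2l // cascade_cb_enc.
have -> : ln D%:R = \sum_z cb_output W (row_index m) cb z * ln D%:R.
  by rewrite -mulr_suml O1 mul1r.
rewrite -big_split /=; apply: ler_sum => z _.
have [->|on] := eqVneq (cb_output W (row_index m) cb z) 0.
  by rewrite !mul0r addr0.
have op : 0 < cb_output W (row_index m) cb z by rewrite lt_def on O0.
by rewrite lnM ?posrE // mulrDr addrC.
Qed.

End CodebookCode.

(** * Cardinalities and elementary estimates *)

Lemma card_word N B : #|{: word N B}| = (2 ^ (N * B))%N.
Proof. by rewrite card_ffun card_bool card_prod !card_ord mulnC. Qed.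

(** Only four logarithms occur, and [ln 0 = 0] keeps them finite at degenerate crossover
    probabilities. The bound is uniform in the block length and the number of blocks. *)
Lemma ln_bsc_bounded (R : realType) (pa pb q1 : R) :
  exists2 c : R, 0 <= c & forall k (b : bool),
    `|ln (if b then 1 - sel pa pb k else sel pa pb k)
      + (q1 * hnat pa + (1 - q1) * hnat pb)| <= c.
Proof.
set hb := q1 * hnat pa + _.
exists (`|ln (1 - pa)| + `|ln pa| + `|ln (1 - pb)| + `|ln pb| + `|hb|).
  by rewrite !addr_ge0.
move=> k b; apply: (le_trans (ler_normD _ _)); rewrite lerD2r /sel.
have h1 := normr_ge0 (ln (1 - pa)); have h2 := normr_ge0 (ln pa).
have h3 := normr_ge0 (ln (1 - pb)); have h4 := normr_ge0 (ln pb).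
by case: b; case: ifP => _; lra.
Qed.

(** Replaces the positive part of [dev] by a quadratic, so that a variance bound suffices:
    [dev * theta <= theta ^ 2 + dev ^ 2] gives [dev <= r], and then [1 + u <= 2 * expR r]. *)
Lemma ln_1D_le (R : realType) (u dev theta : R) : 0 < theta -> u <= expR dev -> 0 <= u ->
  ln (1 + u) <= ln 2 + theta + dev ^+ 2 / theta.
Proof.
move=> th0 ud u0; set r := theta + dev ^+ 2 / theta.
have r0 : 0 <= r by rewrite addr_ge0 ?divr_ge0 ?sqr_ge0 // ltW.
have dr : dev <= r.
  rewrite -subr_ge0 (_ : r - dev = (theta ^+ 2 + dev ^+ 2 - dev * theta) / theta).
    by rewrite divr_ge0 ?(ltW th0) //; nra.
  by rewrite /r; field; rewrite gt_eqF.
have e1 : 1 <= expR r by have := expR_ge1Dx r; lra.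
have e2 : u <= expR r by rewrite (le_trans ud) // ler_expR.
have <- : ln (2 * expR r) = ln 2 + theta + dev ^+ 2 / theta.
  by rewrite lnM ?posrE ?expR_gt0 // expRK addrA.
by rewrite ler_ln ?posrE ?mulr_gt0 ?expR_gt0 //; lra.
Qed.

Lemma expRN_le_inv (R : realType) (x : R) : 0 < x -> expR (- x) <= x^-1.
Proof.
move=> x0; rewrite expRN lef_pV2 ?posrE ?expR_gt0 //.
by have := expR_ge1Dx x; lra.
Qed.

(** The tangent to [x * ln x] at 1/2, taken at [p] and at [1 - p]. *)
Lemma hnat_le_ln2 (R : realType) (p : R) : 0 <= p -> p <= 1 -> hnat p <= ln 2.
Proof.
move=> p0 p1.
have t (x : R) : 0 <= x -> x * - ln 2 + x - 2^-1 <= x * ln x.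
  move=> x0; have := @mul_ln_div_ge _ x 1 2^-1 x0 ler01.
  rewrite divr1 mulr1 lnV ?posrE // invr_gt0 ltr0n; apply => // /eqP.
  by rewrite oner_eq0.
have := t p p0; have := t (1 - p); rewrite subr_ge0 => /(_ p1).
by rewrite /hnat; lra.
Qed.

Lemma nat_between_expR (R : realType) (a : R) : 0 <= a ->
  exists2 M : nat, expR a <= M%:R & M%:R <= 2 * expR a.
Proof.
move=> a0; exists (Num.truncn (expR a)).+1; first by rewrite ltW // truncnS_gt.
have e1 : 1 <= expR a by have := expR_ge1Dx a; lra.
have : (Num.truncn (expR a))%:R <= expR a by rewrite truncn_le // expR_ge0.
by rewrite -natr1; lra.
Qed.

(** Moves the codebook expectation inside the averages over states and indices, where the
    random-coding bounds apply. *)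
Lemma mean_exchange (R : realType) (T S I : finType) (mu : T -> R) (nu : S -> R)
    (k : R) (F : T -> S -> I -> R) :
  \sum_t mu t * (\sum_s nu s * \sum_i k * F t s i) =
  \sum_s nu s * \sum_i k * \sum_t mu t * F t s i.
Proof.
under eq_bigr do rewrite mulr_sumr.
rewrite exchange_big /=; apply: eq_bigr => s _.
under eq_bigr do rewrite mulrCA mulr_sumr.
rewrite -mulr_sumr exchange_big /=; congr (_ * _); apply: eq_bigr => i _.
by rewrite mulr_sumr; apply: eq_bigr => t _; rewrite mulrCA.
Qed.

Lemma mean_sum_const (R : realType) (S I : finType) (nu : S -> R) (k : R) (G : S -> R) :
  #|I|%:R * k = 1 -> \sum_s nu s * \sum_(i : I) k * G s = \sum_s nu s * G s.
Proof.
move=> Ik; apply: eq_bigr => s _; congr (_ * _).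
transitivity (#|I|%:R * k * G s); last by rewrite Ik mul1r.
by rewrite sumr_const -[(k * _) *+ _]mulr_natl mulrA.
Qed.

(** * Second-moment bounds for uniform inputs *)

Section UniformInput.
Variables (R : realType) (N B : nat) (q1 pa pb c : R).
Hypotheses (q0 : 0 <= q1) (qle : q1 <= 1).
Hypotheses (pa0 : 0 <= pa) (pa1 : pa <= 1) (pb0 : 0 <= pb) (pb1 : pb <= 1).

Let n : R := (N * B)%:R.
Let hb : R := q1 * hnat pa + (1 - q1) * hnat pb.
Let D : R := #|{: word N B}|%:R.

Hypothesis hc : forall k (b : bool),
  `|ln (if b then 1 - sel pa pb k else sel pa pb k) + hb| <= c.

Let D0 : 0 < D.
Proof. by rewrite ltr0n card_word expn_gt0. Qed.

Let DE : D = expR (n * ln 2).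
Proof. by rewrite /D card_word expRM_natl lnK ?posrE ?ltr0n // natrX. Qed.

Lemma uniform_input_mean (F : word N B -> R) (b : R) :
  (forall x, F x <= b) -> D^-1 * \sum_x F x <= b.
Proof.
move=> Fb; apply: (@le_trans _ _ (D^-1 * \sum_(x : word N B) b)).
  by rewrite ler_wpM2l ?invr_ge0 ?(ltW D0) // ler_sum.
by rewrite sumr_const -[b *+ _]mulr_natl mulKf // gt_eqF.
Qed.

Lemma uniform_input_variance : \sum_(s : stseq B) PS q1 s *
   (D^-1 * \sum_(x : word N B) \sum_(y : word N B) bsc pa pb s x y * (ln (bsc pa pb s x y)
       + n * hb) ^+ 2)
  <= c ^+ 2 * (B * N ^ 2)%:R.
Proof.
under eq_bigr do rewrite mulrCA mulr_sumr.
rewrite -mulr_sumr exchange_big /=; apply: uniform_input_mean => x.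
exact: info_density_variance.
Qed.

(** Chebyshev's inequality: as [D = expR (n * ln 2)], the event forces the centred log-likelihood
    below [- n * delta]. *)
Lemma uniform_input_tail (delta : R) : 0 < n * delta ->
  \sum_(s : stseq B) PS q1 s * (D^-1 * \sum_(x : word N B) \sum_(y : word N B) bsc pa pb s x y *
    (D * bsc pa pb s x y <= expR (n * (ln 2 - hb - delta)))%R%:R)
  <= c ^+ 2 * (B * N ^ 2)%:R / (n * delta) ^+ 2.
Proof.
move=> nd; apply: (@le_trans _ _ ((\sum_(s : stseq B) PS q1 s *
   (D^-1 * \sum_(x : word N B) \sum_(y : word N B) bsc pa pb s x y * (ln (bsc pa pb s x y)
       + n * hb) ^+ 2))
   / (n * delta) ^+ 2)); last first.
  by rewrite ler_wpM2r ?invr_ge0 ?sqr_ge0 //; exact: uniform_input_variance.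
rewrite mulr_suml; apply: ler_sum => s _; rewrite -mulrA ler_wpM2l ?PS_ge0 //.
rewrite -mulrA ler_wpM2l ?invr_ge0 ?(ltW D0) // mulr_suml; apply: ler_sum => x _.
rewrite mulr_suml; apply: ler_sum => y _; rewrite -mulrA.
set w := bsc _ _ _ _ _; have w0 : 0 <= w by exact: bsc_ge0.
have [->|wn] := eqVneq w 0; first by rewrite !mul0r.
have wp : 0 < w by rewrite lt_def wn.
rewrite ler_wpM2l //; have [|_] /= := leP (D * w) _; last by rewrite divr_ge0 ?sqr_ge0.
rewrite -[X in X <= _ -> _]lnK ?posrE ?mulr_gt0 // ler_expR lnM ?posrE // DE expRK => wt.
rewrite ler_pdivlMr ?exprn_gt0 // mul1r -[leRHS]sqrrN ler_sqr ?nnegrE ?(ltW nd) //; nra.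
Qed.

Lemma uniform_input_covering (L : nat) (theta : R) : 0 < theta ->
  expR (n * (ln 2 - hb)) <= L%:R ->
  \sum_(s : stseq B) PS q1 s * (D^-1 * \sum_(x : word N B) \sum_(y : word N B) bsc pa pb s x y *
    ln (1 + D * bsc pa pb s x y / L%:R))
  <= ln 2 + theta + c ^+ 2 * (B * N ^ 2)%:R / theta.
Proof.
move=> th0 hL; have Lp : 0 < L%:R :> R by rewrite (lt_le_trans _ hL) ?expR_gt0.
apply: (@le_trans _ _ (\sum_(s : stseq B) (PS q1 s * (ln 2 + theta) + PS q1 s *
   (D^-1 * \sum_(x : word N B) \sum_(y : word N B) bsc pa pb s x y * (ln (bsc pa pb s x y)
       + n * hb) ^+ 2)
   / theta))); last first.
  rewrite big_split /= -!mulr_suml PS_sum1 // mul1r lerD2l.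
  by rewrite ler_wpM2r ?invr_ge0 ?(ltW th0) //; exact: uniform_input_variance.
apply: ler_sum => s _; rewrite -mulrA -mulrDr ler_wpM2l ?PS_ge0 //.
have -> : ln 2 + theta = D^-1 * \sum_(x : word N B) (ln 2 + theta).
  by rewrite sumr_const -[(_ + _) *+ _]mulr_natl mulKf // gt_eqF.
rewrite -mulrA -mulrDr ler_wpM2l ?invr_ge0 ?(ltW D0) // mulr_suml -big_split /=.
apply: ler_sum => x _.
have -> : ln 2 + theta = \sum_(y : word N B) bsc pa pb s x y * (ln 2 + theta).
  by rewrite -mulr_suml bsc_sum1 mul1r.
rewrite mulr_suml -big_split /=; apply: ler_sum => y _.
rewrite -[X in _ <= _ + X]mulrA -mulrDr.
set w := bsc _ _ _ _ _; have w0 : 0 <= w by exact: bsc_ge0.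
have [->|wn] := eqVneq w 0; first by rewrite !mul0r.
have wp : 0 < w by rewrite lt_def wn.
(* Here [dev = ln w + n * hb]: the lower bound on [L] gives [D * w / L <= expR dev]. *)
rewrite ler_wpM2l // ln_1D_le ?divr_ge0 ?mulr_ge0 ?(ltW D0) ?(ltW Lp) //.
rewrite ler_pdivrMr // expRD lnK ?posrE // [leLHS]mulrC -mulrA ler_wpM2l // DE.
rewrite (_ : n * ln 2 = n * hb + n * (ln 2 - hb)); last by ring.
by rewrite expRD ler_wpM2l ?expR_ge0.
Qed.

End UniformInput.

(** One codebook has to serve both criteria, so the sum of error and normalised leakage is averaged.
    Both terms being nonnegative, a bound on the sum bounds each. *)
Lemma random_code_exists (R : realType) (q1 p1 p2 ps1 ps2 c1 c2 delta theta : R)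
    (N B M L : nat) :
  let n : R := (N * B)%:R in
  let hY := q1 * hnat p1 + (1 - q1) * hnat p2 in
  let hZ := q1 * hnat ps1 + (1 - q1) * hnat ps2 in
  0 <= q1 -> q1 <= 1 -> 0 <= p1 -> p1 <= 1 -> 0 <= p2 -> p2 <= 1 ->
  0 <= ps1 -> ps1 <= 1 -> 0 <= ps2 -> ps2 <= 1 ->
  (forall k (b : bool), `|ln (if b then 1 - sel p1 p2 k else sel p1 p2 k) + hY| <= c1) ->
  (forall k (b : bool), `|ln (if b then 1 - sel ps1 ps2 k else sel ps1 ps2 k) + hZ| <= c2) ->
  (0 < M)%N -> (0 < L)%N -> 0 < n -> 0 < delta -> 0 < theta ->
  expR (n * (ln 2 - hZ)) <= L%:R ->
  exists c : Defs.code R N B, msize c = M /\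
    err_prob q1 p1 p2 c + leakage q1 ps1 ps2 c * ln 2 / n <=
    c1 ^+ 2 * (B * N ^ 2)%:R / (n * delta) ^+ 2 +
    (M * L)%:R / expR (n * (ln 2 - hY - delta)) +
    (ln 2 + theta + c2 ^+ 2 * (B * N ^ 2)%:R / theta) / n.
Proof.
move=> n hY hZ q0 qle p10 p1l p20 p2l ps10 ps1l ps20 ps2l hc1 hc2 M0 L0 n0 d0 th0 hL.
set t := expR _; have t0 : 0 < t by exact: expR_gt0.
pose i0 : 'I_M * 'I_L := (Ordinal M0, Ordinal L0).
have X0 : (0 < #|{: word N B}|)%N by rewrite card_word expn_gt0.
pose mu := @cbw R (word N B) ('I_M * 'I_L)%type.
pose C (cb : {ffun 'I_M * 'I_L -> word N B}) := cb_code M0 L0 p1 p2 t i0 cb.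
have Wc (pa pb : R) (s : stseq B) (y : word N B) : \sum_x bsc pa pb s x y = 1.
  by rewrite -[RHS](bsc_sum1 pa pb s y); apply: eq_bigr => x _; rewrite bscC.
have cI : #|{: 'I_M * 'I_L}| = (M * L)%N by rewrite card_prod !card_ord.
have err : \sum_cb mu cb * err_prob q1 p1 p2 (C cb) <=
    c1 ^+ 2 * (B * N ^ 2)%:R / (n * delta) ^+ 2 + (M * L)%:R / t.
  apply: le_trans (ler_sum _ (fun cb _ => ler_wpM2l (cbw_ge0 R cb)
    (cb_err_prob_le M0 L0 t i0 q0 qle p10 p1l p20 p2l cb))) _.
  rewrite mean_exchange.
  apply: le_trans (ler_sum _ (fun s _ => ler_wpM2l (PS_ge0 q0 qle s)
    (ler_sum _ (fun i _ => ler_wpM2l _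
      (threshold_decoding (bsc_ge0 p10 p1l p20 p2l s) (bsc_sum1 p1 p2 s) (Wc p1 p2 s) X0 i0
          t0 i))))) _.
    by rewrite invr_ge0.
  rewrite mean_sum_const; last by rewrite divff // cI pnatr_eq0 -lt0n muln_gt0 M0.
  under eq_bigr do rewrite mulrDr.
  rewrite big_split /= -mulr_suml PS_sum1 // mul1r cI lerD2r.
  by apply: uniform_input_tail => //; rewrite mulr_gt0.
have leak : \sum_cb mu cb * (leakage q1 ps1 ps2 (C cb) * ln 2) <=
    ln 2 + theta + c2 ^+ 2 * (B * N ^ 2)%:R / theta.
  apply: le_trans (ler_sum _ (fun cb _ => ler_wpM2l (cbw_ge0 R cb)
    (cb_leakage_le M0 L0 p1 p2 t i0 q0 qle ps10 ps1l ps20 ps2l cb))) _.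
  rewrite mean_exchange.
  apply: le_trans (ler_sum _ (fun s _ => ler_wpM2l (PS_ge0 q0 qle s)
    (ler_sum _ (fun m _ => ler_wpM2l _
      (soft_covering (bsc_ge0 ps10 ps1l ps20 ps2l s) (Wc ps1 ps2 s) X0 L0 _))))) _.
  - by rewrite invr_ge0.
  (* Distinct columns of a row are distinct codebook indices, the injectivity that soft covering
     asks for. *)
  - by move=> s _ m _ l l' [].
  rewrite mean_sum_const; last by rewrite card_ord divff // pnatr_eq0 -lt0n.
  exact: uniform_input_covering.
have [cb hcb] : exists cb, err_prob q1 p1 p2 (C cb) + leakage q1 ps1 ps2 (C cb) * ln 2 / n <=
    c1 ^+ 2 * (B * N ^ 2)%:R / (n * delta) ^+ 2 + (M * L)%:R / t +
    (ln 2 + theta + c2 ^+ 2 * (B * N ^ 2)%:R / theta) / n.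
  apply: (@exists_le_mean _ _ mu (fun cb => err_prob q1 p1 p2 (C cb)
    + leakage q1 ps1 ps2 (C cb) * ln 2 / n)); [exact: cbw_ge0|exact: cbw_sum1|].
  under eq_bigr do rewrite mulrDr mulrA.
  by rewrite big_split /= -mulr_suml lerD // ler_wpM2r // invr_ge0 ltW.
by exists (C cb).
Qed.

(** * Secrecy capacity *)

Section CodeFacts.
Variables (R : realType) (N B : nat) (c : Defs.code R N B).

Lemma rate_ge0 : 0 <= rate c.
Proof.
by rewrite /rate /log2 !divr_ge0 ?ler0n ?(ltW (ln2_gt0 R)) // ln_ge0 // ler1n msize_gt0.
Qed.

Lemma err_prob_ge0 (q1 p1 p2 : R) :
  0 <= q1 -> q1 <= 1 -> 0 <= p1 -> p1 <= 1 -> 0 <= p2 -> p2 <= 1 ->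
  0 <= err_prob q1 p1 p2 c.
Proof.
move=> q0 qle p10 p1l p20 p2l.
apply: sumr_ge0 => s _; apply: mulr_ge0; first exact: PS_ge0.
apply: sumr_ge0 => m _; apply: mulr_ge0; first by rewrite invr_ge0.
apply: sumr_ge0 => x _; apply: mulr_ge0; first exact: enc_ge0.
by apply: sumr_ge0 => y _; apply: mulr_ge0 => //; exact: bsc_ge0.
Qed.

Lemma leakage_ge0 (q1 ps1 ps2 : R) :
  0 <= q1 -> q1 <= 1 -> 0 <= ps1 -> ps1 <= 1 -> 0 <= ps2 -> ps2 <= 1 ->
  0 <= leakage q1 ps1 ps2 c.
Proof.
move=> q0 qle p10 p1l p20 p2l; rewrite leakageE.
rewrite divr_ge0 ?(ltW (ln2_gt0 R)) // sumr_ge0 // => s _.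
rewrite mulr_ge0 ?PS_ge0 //.
have W0 (x y : word N B) : 0 <= bsc ps1 ps2 s x y by exact: bsc_ge0.
apply: mutinf_ge0 => [m|||].
- by rewrite invr_ge0.
- by apply: cascade_ge0 => // m x; exact: enc_ge0.
- by rewrite sumr_const card_ord -[(_^-1) *+ _]mulr_natl divff // pnatr_eq0 -lt0n msize_gt0.
- by apply: cascade_sum1 => [m|x]; [exact: enc_sum1|exact: bsc_sum1].
Qed.

End CodeFacts.

Lemma trivial_code_exists (R : realType) (N B : nat) (q1 p1 p2 ps1 ps2 : R) :
  exists c : Defs.code R N B, err_prob q1 p1 p2 c = 0 /\ leakage q1 ps1 ps2 c = 0.
Proof.
pose e (m : 'I_1) : {ffun word N B -> R} := [ffun x => (x == [ffun=> false])%:R].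
have e0 m x : 0 <= e m x by rewrite ffunE.
have e1 m : \sum_x e m x = 1.
  rewrite (bigD1 [ffun=> false]) //= ffunE eqxx big1 ?addr0 // => x /negPf.
  by rewrite ffunE => ->.
exists (Code (ltn0Sn 0) e0 e1 (fun _ _ => ord0)); split; apply: big1 => s _.
  rewrite big1 ?mulr0 // => m _; rewrite big1 ?mulr0 // => x _.
  by rewrite big1 ?mulr0 // => y _; rewrite [m]ord1 eqxx mulr0.
rewrite big1 ?mulr0 // => m _; rewrite big1 // => z _ /=; case: eqP => // /eqP h.
rewrite /pZ big_ord1 invr1 mul1r [m]ord1 divff; first by rewrite /log2 ln1 mul0r mulr0.
by rewrite [m]ord1 in h.
Qed.

(** With [v = j + 1], taking [N = v] and [B = v ^ 2] gives length [n = v ^ 3], while the variance is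
    of order [B * N ^ 2 = v ^ 4]; every error term is then of order [1 / v] or smaller. *)
Lemma code_sequence_exists (R : realType) (q1 p1 p2 ps1 ps2 delta : R) :
  let Cn := q1 * (hnat ps1 - hnat p1) + (1 - q1) * (hnat ps2 - hnat p2) in
  0 <= q1 -> q1 <= 1 -> 0 <= p1 -> p1 <= 1 -> 0 <= p2 -> p2 <= 1 ->
  0 <= ps1 -> ps1 <= 1 -> 0 <= ps2 -> ps2 <= 1 ->
  0 < delta -> 0 <= Cn - 2 * delta ->
  exists K : R, forall j : nat, exists c : Defs.code R j.+1 (j.+1 ^ 2),
    [/\ (Cn - 2 * delta) / ln 2 <= rate c, `|err_prob q1 p1 p2 c| <= K / j.+1%:R &
        `|leakage q1 ps1 ps2 c / (j.+1 * j.+1 ^ 2)%:R| <= K / j.+1%:R].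
Proof.
move=> Cn q0 qle p10 p1l p20 p2l ps10 ps1l ps20 ps2l d0 Cd.
have [c1 c10 hc1] := ln_bsc_bounded p1 p2 q1.
have [c2 c20 hc2] := ln_bsc_bounded ps1 ps2 q1.
set hY := q1 * hnat p1 + _ in hc1; set hZ := q1 * hnat ps1 + _ in hc2.
have CE : Cn = hZ - hY by rewrite /Cn /hZ /hY; ring.
have l2 := ln2_gt0 R.
(* The first summand is for the decoding tail, the second for wrong codewords, the rest for soft
   covering; below, [K0 / ln 2] covers the leakage in bits. *)
pose K0 := c1 ^+ 2 / delta ^+ 2 + 4 / delta + ln 2 + 1 + c2 ^+ 2.
exists (K0 + K0 / ln 2) => j; have [v vE] : {v : R | v = j.+1%:R} by exists j.+1%:R.
have v1 : 1 <= v by rewrite vE ler1n.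
have v0 : 0 < v by rewrite (lt_le_trans ltr01).
have nE : (j.+1 * j.+1 ^ 2)%:R = v ^+ 3 :> R by rewrite vE natrM natrX -exprS.
have n0 : 0 < v ^+ 3 by rewrite exprn_gt0.
have hZ0 : 0 <= ln 2 - hZ.
  have := hnat_le_ln2 ps10 ps1l; have := hnat_le_ln2 ps20 ps2l.
  by rewrite /hZ; nra.
have [M M1 M2] := nat_between_expR (mulr_ge0 (ltW n0) Cd).
have [L L1 L2] := nat_between_expR (mulr_ge0 (ltW n0) hZ0).
have M0 : (0 < M)%N by rewrite -(ltr0n R) (lt_le_trans _ M1) // expR_gt0.
have L0 : (0 < L)%N by rewrite -(ltr0n R) (lt_le_trans _ L1) // expR_gt0.
(* The choice [theta = v ^ 2] balances [theta] against [v ^ 4 / theta]. *)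
have := @random_code_exists R q1 p1 p2 ps1 ps2 c1 c2 delta (v ^+ 2) j.+1 (j.+1 ^ 2) M L.
rewrite nE -/hY -/hZ => /(_ q0 qle p10 p1l p20 p2l ps10 ps1l ps20 ps2l hc1 hc2 M0 L0 n0 d0).
rewrite exprn_gt0 // => /(_ isT L1) [c [Mc bnd]]; exists c.
have e0 := err_prob_ge0 c q0 qle p10 p1l p20 p2l.
have lk0 := leakage_ge0 c q0 qle ps10 ps1l ps20 ps2l.
(* The exponents of [M] and [L] add up to [n * (ln 2 - hY - 2 * delta)], short of the threshold by
   [n * delta]; the 4 comes from rounding both sizes up to integers. *)
have ML : (M * L)%:R / expR (v ^+ 3 * (ln 2 - hY - delta)) <= 4 / delta / v.
  apply: (@le_trans _ _ (4 * (v ^+ 3 * delta)^-1)).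
    apply: (@le_trans _ _ (4 * expR (- (v ^+ 3 * delta)))); last first.
      by rewrite ler_wpM2l // expRN_le_inv // mulr_gt0.
    rewrite ler_pdivrMr ?expR_gt0 // -mulrA -expRD natrM.
    apply: (@le_trans _ _ ((2 * expR (v ^+ 3 * (Cn - 2 * delta))) * (2 * expR (v ^+ 3 * (ln
        2 - hZ))))).
      by rewrite ler_pM.
    rewrite mulrACA -expRD CE le_eqVlt; apply/orP; left; apply/eqP.
    by congr (_ * expR _); [rewrite -natrM|ring].
  rewrite -mulrA ler_wpM2l // invfM mulrC ler_wpM2l ?invr_ge0 ?(ltW d0) //.
  by rewrite lef_pV2 ?posrE // -[leLHS]expr1 ler_weXn2l.
have {}bnd : err_prob q1 p1 p2 c + leakage q1 ps1 ps2 c * ln 2 / v ^+ 3 <= K0 / v.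
  apply: (le_trans bnd).
  have -> : (j.+1 ^ 2 * j.+1 ^ 2)%:R = v ^+ 4 :> R by rewrite vE -expnD natrX.
  have vn : v != 0 by rewrite gt_eqF.
  have dn : delta != 0 by rewrite gt_eqF.
  rewrite (_ : c1 ^+ 2 * v ^+ 4 / (v ^+ 3 * delta) ^+ 2 =
    c1 ^+ 2 / delta ^+ 2 / v * v^-1); last by field; rewrite vn dn.
  rewrite (_ : (ln 2 + v ^+ 2 + c2 ^+ 2 * v ^+ 4 / v ^+ 2) / v ^+ 3 =
    ln 2 / v * (v^-1 * v^-1) + 1 / v + c2 ^+ 2 / v); last by field.
  have vi : v^-1 <= 1 by rewrite invf_le1.
  have vi0 : 0 <= v^-1 by rewrite invr_ge0 ltW.
  have a1 : c1 ^+ 2 / delta ^+ 2 / v * v^-1 <= c1 ^+ 2 / delta ^+ 2 / v.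
    by rewrite -[leRHS]mulr1 ler_wpM2l // !divr_ge0 ?sqr_ge0 // ltW.
  have a2 : ln 2 / v * (v^-1 * v^-1) <= ln 2 / v.
    by rewrite -[leRHS]mulr1 ler_wpM2l ?mulr_ile1 // divr_ge0 // ltW.
  by rewrite /K0 !mulrDl; lra.
have K00 : 0 <= K0.
  by rewrite /K0 !addr_ge0 ?divr_ge0 ?sqr_ge0 // ltW.
have lkn : 0 <= leakage q1 ps1 ps2 c / v ^+ 3 by rewrite divr_ge0 // ltW.
have eb : err_prob q1 p1 p2 c <= K0 / v.
  by apply: le_trans bnd; rewrite lerDl mulrAC mulr_ge0 // ltW.
have lb : leakage q1 ps1 ps2 c / v ^+ 3 <= K0 / ln 2 / v.
  rewrite mulrAC ler_pdivlMr //; apply: le_trans bnd.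
  by rewrite mulrAC lerDr.
rewrite -vE; split.
- rewrite /rate /log2 Mc nE -mulrA -invfM [ln 2 * _]mulrC invfM mulrA ler_wpM2r ?invr_ge0
    ?(ltW l2) //.
  rewrite ler_pdivlMr // mulrC -[leLHS]expRK ler_ln ?posrE ?expR_gt0 //.
  by rewrite ltr0n.
- by rewrite ger0_norm // (le_trans eb) // ler_wpM2r ?lerDl ?divr_ge0 ?invr_ge0 // ltW.
- by rewrite ger0_norm // (le_trans lb) // ler_wpM2r ?lerDr ?invr_ge0 // ltW.
Qed.

Lemma eventually_and (P Q : nat -> Prop) : Defs.eventually P -> Defs.eventually Q ->
  Defs.eventually (fun j => P j /\ Q j).
Proof.
move=> [J hJ] [K hK]; exists (maxn J K) => j; rewrite geq_max => /andP[/hJ ? /hK ?].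
by [].
Qed.

Lemma eventually_inv_le (R : realType) (K eps : R) : 0 < eps ->
  Defs.eventually (fun j => K / j.+1%:R <= eps).
Proof.
move=> e0; exists (Num.truncn (K / eps)) => j hj.
rewrite ler_pdivrMr ?ltr0n // mulrC -ler_pdivrMr //.
by rewrite (le_trans (ltW (truncnS_gt _))) // ler_nat.
Qed.

Lemma achievable_le (R : realType) (q1 p1 p2 ps1 ps2 Rt : R) :
  0 <= q1 -> q1 <= 1 ->
  0 <= p1 -> p1 <= ps1 -> ps1 <= 2^-1 ->
  0 <= p2 -> p2 <= ps2 -> ps2 <= 2^-1 ->
  achievable q1 p1 p2 ps1 ps2 Rt ->
  Rt <= q1 * (Hb ps1 - Hb p1) + (1 - q1) * (Hb ps2 - Hb p2).
Proof.
move=> q0 qle p10 p1s ps1h p20 p2s ps2h [N [B [c [hN [hB [hr [he hl]]]]]]].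
rewrite leNgt; apply/negP; set C := (X in X < _) => CR.
have l2 := ln2_gt0 R; have l2n : ln 2 != 0 :> R by rewrite gt_eqF.
have A0 : 0 < 3 + `|Rt| by rewrite ltr_pwDl.
(* Rate slack, leakage and the Fano term cost at most [eps] each and the error probability about
   [eps * Rt]; this choice keeps the total within half of [Rt - C]. *)
pose eps := Num.min 1 ((Rt - C) / (2 * (3 + `|Rt|))).
have eps0 : 0 < eps by rewrite lt_min ltr01 divr_gt0 ?mulr_gt0 // subr_gt0.
have eps1 : eps <= 1 by rewrite ge_min lexx.
have epsC : eps * (2 * (3 + `|Rt|)) <= Rt - C.
  by rewrite -ler_pdivlMr ?mulr_gt0 // ge_min lexx orbT.
(* A single code suffices: block length above [1 / eps] and at least one block make
   [1 / n <= eps]. *)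
have [J hJ] := eventually_and (eventually_and (hN (Num.truncn eps^-1).+1) (hB 1%N))
  (eventually_and (hr _ eps0) (eventually_and (he _ eps0) (hl _ eps0))).
have [[NJ BJ] [rJ [eJ lJ]]] := hJ J (leqnn J).
have := code_converse (c J) q0 qle p10 p1s ps1h p20 p2s ps2h.
set n : R := (N J * B J)%:R in lJ *.
have nge : eps^-1 <= n.
  rewrite (le_trans (ltW (truncnS_gt _))) // ler_nat (leq_trans NJ) //.
  by rewrite -[leqLHS]muln1 leq_mul2l BJ orbT.
have n0 : 0 < n by rewrite (lt_le_trans _ nge) // invr_gt0.
have nn : n != 0 by rewrite gt_eqF.
have ninv : n^-1 <= eps by rewrite -[eps]invrK lef_pV2 ?posrE ?invr_gt0.
have -> : ln (msize (c J))%:R = rate (c J) * n * ln 2.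
  by rewrite /rate /log2 -/n divfK // divfK.
rewrite (_ : q1 * (hnat ps1 - hnat p1) + _ = C * ln 2); last first.
  by rewrite /C !HbE; field.
clearbody n; have r0 := rate_ge0 (c J).
move: rJ eJ lJ r0; set r := rate _; set e := err_prob _ _ _ _; set k := leakage _ _ _ _.
move=> rJ eJ lJ r0 conv.
have eJ' : e <= eps by apply: le_trans eJ; exact: ler_norm.
have lJ' : k / n <= eps by apply: le_trans lJ; exact: ler_norm.
(* The one-shot converse divided by [n * ln 2], in bits per symbol. *)
have conv2 : (1 - e) * r - n^-1 <= k / n + C.
  rewrite -(ler_pM2r (mulr_gt0 n0 l2)).
  have -> : ((1 - e) * r - n^-1) * (n * ln 2) = (1 - e) * (r * n * ln 2) - ln 2 by field.
  by have -> : (k / n + C) * (n * ln 2) = k * ln 2 + n * (C * ln 2) by field.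
have er : e * r <= eps * r by rewrite ler_wpM2r.
have rr : (1 - eps) * (Rt - eps) <= (1 - eps) * r by rewrite ler_wpM2l // subr_ge0.
have ae : eps * Rt <= eps * `|Rt| by rewrite ler_wpM2l ?(ltW eps0) // ler_norm.
have ee : 0 <= eps * eps by rewrite mulr_ge0 // ltW.
have ea : 0 <= eps * `|Rt| by rewrite mulr_ge0 // ltW.
nra.
Qed.

Theorem theorem2 (R : realType) (q1 p1 p2 ps1 ps2 : R) :
  0 <= q1 -> q1 <= 1 ->
  0 <= p1 -> p1 <= p2 -> p2 <= 2^-1 ->
  ps1 <= ps2 -> ps2 <= 2^-1 ->
  p1 <= ps1 -> p2 <= ps2 ->
  is_secrecy_capacity_CSID q1 p1 p2 ps1 ps2
    (q1 * (Hb ps1 - Hb p1) + (1 - q1) * (Hb ps2 - Hb p2)).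
Proof.
move=> q0 qle p10 p12 p2h ps12 ps2h p1s p2s.
have p1le : p1 <= 1 by lra.
have p20 : 0 <= p2 by lra.
have p2le : p2 <= 1 by lra.
have ps1h : ps1 <= 2^-1 by lra.
have ps10 : 0 <= ps1 by lra.
have ps1le : ps1 <= 1 by lra.
have ps20 : 0 <= ps2 by lra.
have ps2le : ps2 <= 1 by lra.
split=> [Rt|eps eps0]; first exact: achievable_le.
set C := q1 * (Hb ps1 - Hb p1) + _; have l2 := ln2_gt0 R.
have l2n : ln 2 != 0 :> R by rewrite gt_eqF.
have CE : q1 * (hnat ps1 - hnat p1) + (1 - q1) * (hnat ps2 - hnat p2) = C * ln 2.
  by rewrite /C !HbE; field.
clearbody C.
have near_id K : Defs.eventually (fun j => (K <= j.+1)%N).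
  by exists K => j; exact: leqW.
have near_sq K : Defs.eventually (fun j => (K <= j.+1 ^ 2)%N).
  by exists K => j Kj; rewrite (leq_trans (leqW Kj)) // -mulnn leq_pmulr.
(* For small [C] rate 0 already exceeds [C - eps], and one-message codes achieve it; otherwise the
   target [C - eps / 2] is nonnegative, as random coding requires. *)
have [Csmall|Clarge] := ltP C (eps / 2).
  exists 0; split; last by lra.
  have E (N B : nat) := cid (trivial_code_exists N B q1 p1 p2 ps1 ps2).
  exists S, (fun j => (j.+1 ^ 2)%N), (fun j => projT1 (E _ _)).
  split; [exact: near_id|split; [exact: near_sq|split; [|split]]].
  - move=> e e0; exists 0%N => j _.
    by have := rate_ge0 (projT1 (E j.+1 (j.+1 ^ 2)%N)); lra.
  - move=> e e0; exists 0%N => j _; case: (E _ _) => c [/= -> _].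
    by rewrite normr0 ltW.
  - move=> e e0; exists 0%N => j _; case: (E _ _) => c [/= _ ->].
    by rewrite mul0r normr0 ltW.
(* The rate loss of [2 * delta] nats is then [eps / 2] bits. *)
pose delta := eps * ln 2 / 4.
have d0 : 0 < delta by rewrite /delta !mulr_gt0 ?invr_gt0.
have Cd : C * ln 2 - 2 * delta = (C - eps / 2) * ln 2 by rewrite /delta; field.
have := @code_sequence_exists R q1 p1 p2 ps1 ps2 delta q0 qle p10 p1le p20 p2le
  ps10 ps1le ps20 ps2le d0.
rewrite CE Cd mulfK // => /(_ _) [|K hK].
  by rewrite mulr_ge0 ?subr_ge0 // ltW.
exists (C - eps / 2); split; last by lra.
pose E j := cid (hK j).
exists S, (fun j => (j.+1 ^ 2)%N), (fun j => projT1 (E j)).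
split; [exact: near_id|split; [exact: near_sq|split; [|split]]].
- move=> e e0; exists 0%N => j _; case: (E j) => c [/= h _ _]; lra.
- move=> e e0; have [J hJ] := eventually_inv_le K e0; exists J => j /hJ le_e.
  by apply: le_trans le_e; case: (E j) => c [].
- move=> e e0; have [J hJ] := eventually_inv_le K e0; exists J => j /hJ le_e.
  by apply: le_trans le_e; case: (E j) => c [].
Qed.
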